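(* Let $t_0 \ge 0.2$ and let $G$ solve $$G''(t) = \left(\frac{2}{(t+t_0)^2} - 3Q(t+t_0)^2\right)G(t), \quad t > 0, \qquad G(0) = 0,\ G'(0) = 1.$$ Then $G(t) > 0$ for all $t > 0$. Moreover, there are constants $c > 0$ and $c_2 > 0$ such that $G(t) > c\,t^{c_2}$ for all $t \ge 2.5$.
   Context: $Q(t)$, $t\ge 0$, denotes the radial profile of the positive radial ground state of $\Delta\phi - \phi + |\phi|^2\phi = 0$ on $\mathbb{R}^3$; it solves $-Q'' - \frac{2}{t}Q' + Q - Q^3 = 0$. *)

(* Defs.v *)
From Stdlib Require Import Reals Lra.
From Coquelicot Require Import Coquelicot.
Open Scope R_scope.

(* [is_ground_state_profile Q] : Q is the radial profile (t >= 0) of the positive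
   radial ground state of  Delta phi - phi + phi^3 = 0  on R^3, i.e.
   Q > 0 on [0,oo), Q is C^2 on (0,oo) with derivative Q1 solving
     -Q'' - (2/t) Q' + Q - Q^3 = 0   for t > 0,
   Q is regular at the origin (right-continuous at 0, Q'(t) -> 0 as t -> 0+),
   and Q(t) -> 0 as t -> +oo.  By the uniqueness theorem (Coffman 1972,
   Kwong 1989) this determines Q uniquely. *)
Definition is_ground_state_profile (Q : R -> R) : Prop :=
  (forall t, 0 <= t -> 0 < Q t) /\
  exists Q1 : R -> R,
    (forall t, 0 < t -> is_derive Q t (Q1 t)) /\
    (forall t, 0 < t ->
        is_derive Q1 t (- (2 / t) * Q1 t + Q t - Q t ^ 3)) /\
    filterlim Q (at_right 0) (locally (Q 0)) /\
    filterlim Q1 (at_right 0) (locally 0) /\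
    filterlim Q (Rbar_locally p_infty) (locally 0).

(* Main.v *)
Require Import Defs.
From Stdlib Require Import Reals Lra Lia ZArith List Bool.
From Coquelicot Require Import Coquelicot.
Import ListNotations.
Open Scope R_scope.

(** Put [s = t + t0], [z = - s Q' / Q], [Y = s^2 Q^2] and [f = s Q].  Then
    [s z' = z^2 - z - s^2 + Y] and [s Y' = 2 Y (1 - z)].  The solutions regular at the
    origin sweep out a surface [Y = s^2 + z b(z, s^2)] which attracts nearby trajectories,
    so polynomials [b_lo < b < b_up] whose defect in the transport equation of [b] has a
    sign confine it, whatever [Q 0] is.  Positivity and decay of [Q] force
    [Q'^2 / 2 + Q^4 / 4 - Q^2 / 2 >= 0], [f'^2 - f^2 + f^4 / (2 s^2) >= 0] and
    [f' + f >= 0]; on the surface at [s = 11/8] these leave only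
    [2339/1024 < z <= 19/8], and following the flow backwards from there pins down [z] and
    [Y] on [[0.2, 11/8]] to within a few percent.  This upper bound on [Y] is sharp
    enough for explicit positive functions [w] with [w'' <= (2 / s^2 - 3 Q^2) w] on
    [[0.2, oo)].  The Wronskian [G' w - G w'] is then nondecreasing, so [G / w] increases
    at a rate bounded below, and [G] grows linearly.

    The critical starting point is about [0.181], which is why numerical precision is
    needed.  The polynomial inequalities are checked by Bernstein expansion over
    dyadic numbers. *)

(** * Dyadic numbers *)

(** The pair (m, e) stands for m / 2^e and is never reduced: exact sums and products then cost only
    shifts and integer operations, with no gcd. *)
Definition dyadic : Type := (Z * N)%type.

Definition dval (d : dyadic) : R := IZR (fst d) / IZR (2 ^ Z.of_N (snd d)).

Definition dadd (a b : dyadic) : dyadic :=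
  let (m, e) := a in let (m', e') := b in
  if (e <=? e')%N then ((Z.shiftl m (Z.of_N (e' - e)) + m')%Z, e')
  else ((m + Z.shiftl m' (Z.of_N (e - e')))%Z, e).

Definition dmul (a b : dyadic) : dyadic :=
  ((fst a * fst b)%Z, (snd a + snd b)%N).

Definition dhalf (a : dyadic) : dyadic := (fst a, N.succ (snd a)).

(** Rounding towards minus infinity to [k] fractional bits. It limits the size of the integers, and
    one-sided rounding is enough to prove lower bounds. *)
Definition dfloor (k : N) (a : dyadic) : dyadic :=
  if (snd a <=? k)%N then a
  else (Z.shiftr (fst a) (Z.of_N (snd a - k)), k).

Definition dzero : dyadic := (0%Z, 0%N).

Definition dpos (a : dyadic) : bool := (0 <? fst a)%Z.

Lemma pow2_pos (e : N) : 0 < IZR (2 ^ Z.of_N e).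
Proof. apply IZR_lt, Z.pow_pos_nonneg; lia. Qed.

Lemma pow2_add (e f : N) :
  IZR (2 ^ Z.of_N (e + f)) = IZR (2 ^ Z.of_N e) * IZR (2 ^ Z.of_N f).
Proof. rewrite N2Z.inj_add, Z.pow_add_r, mult_IZR by lia; reflexivity. Qed.

Lemma dval_shift (m : Z) (e f : N) :
  (e <= f)%N -> dval (Z.shiftl m (Z.of_N (f - e)), f) = dval (m, e).
Proof.
  intros Hef; unfold dval; simpl.
  rewrite Z.shiftl_mul_pow2, mult_IZR by lia.
  replace f with (e + (f - e))%N at 2 by lia.
  rewrite pow2_add.
  pose proof (pow2_pos e); pose proof (pow2_pos (f - e)).
  field; lra.
Qed.

Lemma dval_plus (m n : Z) (e : N) : dval ((m + n)%Z, e) = dval (m, e) + dval (n, e).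
Proof. unfold dval; simpl; rewrite plus_IZR; apply Rdiv_plus_distr. Qed.

Lemma dval_add (a b : dyadic) : dval (dadd a b) = dval a + dval b.
Proof.
  destruct a as [m e], b as [n f]; unfold dadd.
  destruct (N.leb_spec e f) as [H | H]; rewrite dval_plus, dval_shift by lia;
    reflexivity.
Qed.

Lemma dval_mul (a b : dyadic) : dval (dmul a b) = dval a * dval b.
Proof.
  destruct a as [m e], b as [n f]; unfold dval, dmul; simpl fst; simpl snd.
  rewrite pow2_add, mult_IZR.
  pose proof (pow2_pos e); pose proof (pow2_pos f); field; lra.
Qed.

Lemma dval_half (a : dyadic) : dval (dhalf a) = dval a / 2.
Proof.
  destruct a as [m e]; unfold dval, dhalf; simpl fst; simpl snd.
  rewrite <- N.add_1_r, pow2_add; pose proof (pow2_pos e).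
  change (IZR (2 ^ Z.of_N 1)) with 2; field; lra.
Qed.

Lemma dval_floor (k : N) (a : dyadic) : dval (dfloor k a) <= dval a.
Proof.
  destruct a as [m e]; unfold dfloor; simpl.
  destruct (N.leb_spec e k) as [H | H]; [apply Rle_refl |].
  rewrite <- (dval_shift _ k e) by lia.
  unfold dval; simpl; apply Rmult_le_compat_r;
    [left; apply Rinv_0_lt_compat, pow2_pos | apply IZR_le].
  rewrite Z.shiftr_div_pow2, Z.shiftl_mul_pow2 by lia.
  rewrite Z.mul_comm; apply Z.mul_div_le, Z.pow_pos_nonneg; lia.
Qed.

Lemma dval_zero : dval dzero = 0.
Proof. unfold dval; simpl; lra. Qed.

Lemma dval_pos (a : dyadic) : dpos a = true -> 0 < dval a.
Proof.
  intros H; apply Z.ltb_lt in H.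
  apply Rdiv_lt_0_compat; [apply IZR_lt, H | apply pow2_pos].
Qed.

(** * Polynomials as coefficient lists, over coefficients evaluated by [ev] *)

(** Abstracting the coefficients lets the same operations and lemmas serve both levels of a
    bivariate polynomial stored as a list of lists. *)
Definition peval {A : Type} (ev : A -> R) (p : list A) (x : R) : R :=
  fold_right (fun c r => ev c + x * r) 0 p.

Fixpoint padd {A : Type} (add : A -> A -> A) (p q : list A) : list A :=
  match p, q with
  | [], _ => q
  | _, [] => p
  | a :: p', b :: q' => add a b :: padd add p' q'
  end.

Fixpoint pmul {A : Type} (zero : A) (add mul : A -> A -> A) (p q : list A) : list A :=
  match p with
  | [] => []
  | a :: p' => padd add (map (mul a) q) (zero :: pmul zero add mul p' q)
  end.

(** Product rule on the Horner form, (a + x p)' = p + x p', which avoids multiplying coefficients by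
    integers. *)
Fixpoint pderiv {A : Type} (zero : A) (add : A -> A -> A) (p : list A) : list A :=
  match p with
  | [] => []
  | a :: p' => padd add p' (zero :: pderiv zero add p')
  end.

(** Taylor shift x -> 1 + x, from a + (1 + x) q = (a + x q) + q. *)
Fixpoint pshift {A : Type} (add : A -> A -> A) (p : list A) : list A :=
  match p with
  | [] => []
  | a :: p' => let q := pshift add p' in padd add (a :: q) q
  end.

Fixpoint pscale_half {A : Type} (half : A -> A) (p : list A) : list A :=
  match p with
  | [] => []
  | a :: p' => a :: map half (pscale_half half p')
  end.

(* Bernstein test: [x^n p(1/x)] expanded at [x = 1] has positive coefficients only. *)
Definition ppos {A : Type} (add : A -> A -> A) (pos : A -> bool) (p : list A) : bool :=
  match p with
  | [] => false
  | _ => forallb pos (pshift add (rev p))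
  end.

Lemma peval_add {A : Type} (ev : A -> R) (add : A -> A -> A)
    (Hadd : forall a b, ev (add a b) = ev a + ev b) (p q : list A) (x : R) :
  peval ev (padd add p q) x = peval ev p x + peval ev q x.
Proof.
  revert q; induction p as [| a p IH]; intros [| b q]; simpl; try ring.
  rewrite Hadd, IH; ring.
Qed.

Lemma peval_map {A : Type} (ev : A -> R) (f : A -> A) (k : R)
    (Hf : forall a, ev (f a) = k * ev a) (p : list A) (x : R) :
  peval ev (map f p) x = k * peval ev p x.
Proof. induction p as [| a p IH]; simpl; [| rewrite Hf, IH]; ring. Qed.

Lemma peval_mul {A : Type} (ev : A -> R) (zero : A) (add mul : A -> A -> A)
    (Hzero : ev zero = 0) (Hadd : forall a b, ev (add a b) = ev a + ev b)
    (Hmul : forall a b, ev (mul a b) = ev a * ev b) (p q : list A) (x : R) :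
  peval ev (pmul zero add mul p q) x = peval ev p x * peval ev q x.
Proof.
  induction p as [| a p IH]; simpl; [ring |].
  rewrite peval_add by apply Hadd.
  rewrite (peval_map ev (mul a) (ev a)) by apply Hmul.
  simpl; rewrite IH, Hzero; ring.
Qed.

Lemma peval_shift {A : Type} (ev : A -> R) (add : A -> A -> A)
    (Hadd : forall a b, ev (add a b) = ev a + ev b) (p : list A) (x : R) :
  peval ev (pshift add p) x = peval ev p (1 + x).
Proof.
  induction p as [| a p IH]; [reflexivity |].
  cbn [pshift]; cbv zeta; rewrite peval_add by apply Hadd; simpl; rewrite IH; ring.
Qed.

Lemma peval_scale_half {A : Type} (ev : A -> R) (half : A -> A)
    (Hhalf : forall a, ev (half a) = ev a / 2) (p : list A) (x : R) :
  peval ev (pscale_half half p) x = peval ev p (x / 2).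
Proof.
  induction p as [| a p IH]; [reflexivity |]; simpl.
  rewrite (peval_map ev half (/ 2)), IH by (intros; rewrite Hhalf; field); field.
Qed.

Lemma peval_app {A : Type} (ev : A -> R) (p q : list A) (x : R) :
  peval ev (p ++ q) x = peval ev p x + x ^ length p * peval ev q x.
Proof. induction p as [| a p IH]; simpl; [| rewrite IH]; ring. Qed.

(** The factor [x] on the left avoids the truncated exponent [length p - 1]. *)
Lemma peval_rev {A : Type} (ev : A -> R) (p : list A) (x : R) :
  x <> 0 -> x * peval ev (rev p) x = x ^ length p * peval ev p (/ x).
Proof.
  intros Hx; induction p as [| a p IH]; simpl; [ring |].
  rewrite peval_app, length_rev, Rmult_plus_distr_l, IH; simpl; field; exact Hx.
Qed.

Lemma peval_pos {A : Type} (ev : A -> R) (p : list A) (x : R) :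
  p <> [] -> (forall a, In a p -> 0 < ev a) -> 0 <= x -> 0 < peval ev p x.
Proof.
  intros Hp H Hx; induction p as [| a p IH]; [congruence |].
  simpl; assert (Ha : 0 < ev a) by (apply H; left; reflexivity).
  destruct p as [| b p]; [simpl; lra |].
  assert (0 < peval ev (b :: p) x) by (apply IH; [discriminate | intros; apply H; right; assumption]).
  nra.
Qed.

Lemma pshift_nonnil {A : Type} (add : A -> A -> A) (p : list A) :
  p <> [] -> pshift add p <> [].
Proof. destruct p as [| a p]; [congruence |]; simpl; destruct (pshift add p); discriminate. Qed.

(** For 0 < u <= 1 one has 1/u = 1 + v with v >= 0, so the shifted reversed polynomial is evaluated
    at v >= 0, where positive coefficients give a positive value; [peval_rev] carries the sign back
    to u. *)
Lemma ppos_sound {A : Type} (ev : A -> R) (add : A -> A -> A) (pos : A -> bool)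
    (Hadd : forall a b, ev (add a b) = ev a + ev b)
    (Hpos : forall a, pos a = true -> 0 < ev a) (p : list A) (u : R) :
  ppos add pos p = true -> 0 < u <= 1 -> 0 < peval ev p u.
Proof.
  intros H [Hu0 Hu1].
  assert (Hp : p <> [] /\ forallb pos (pshift add (rev p)) = true)
    by (destruct p; [discriminate H | split; [discriminate | exact H]]).
  destruct Hp as [Hp Hall].
  assert (Hx : 1 <= / u) by (rewrite <- Rinv_1; apply Rinv_le_contravar; lra).
  assert (Hrev : 0 < peval ev (rev p) (/ u)).
  { replace (/ u) with (1 + (/ u - 1)) by ring.
    rewrite <- (peval_shift ev add Hadd).
    apply peval_pos; [| | lra].
    - apply pshift_nonnil; intros E; apply Hp.
      rewrite <- (rev_involutive p), E; reflexivity.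
    - intros a Ha; apply Hpos; rewrite forallb_forall in Hall; auto. }
  pose proof (peval_rev ev p (/ u) ltac:(lra)) as E.
  rewrite Rinv_inv in E.
  assert (0 < (/ u) ^ length p) by (apply pow_lt; lra).
  assert (0 < (/ u) ^ length p * peval ev p u) by (rewrite <- E; nra).
  nra.
Qed.

(** * Bivariate dyadic polynomials *)

(* The outer list is indexed by powers of [x], the inner ones by powers of [y]. *)
Definition poly2 : Type := list (list dyadic).

Definition ev1 (p : list dyadic) (y : R) : R := peval dval p y.
Definition ev2 (p : poly2) (x y : R) : R := peval (fun c => ev1 c y) p x.

Definition add1 : list dyadic -> list dyadic -> list dyadic := padd dadd.
Definition mul1 : list dyadic -> list dyadic -> list dyadic := pmul dzero dadd dmul.
Definition add2 : poly2 -> poly2 -> poly2 := padd add1.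
Definition mul2 : poly2 -> poly2 -> poly2 := pmul [] add1 mul1.
Definition const2 (d : dyadic) : poly2 := [[d]].
Definition int2 (n : Z) : poly2 := const2 (n, 0%N).
Definition sub2 (p q : poly2) : poly2 := add2 p (mul2 (int2 (-1)) q).
Definition X2 : poly2 := [[]; [(1%Z, 0%N)]].
Definition Y2 : poly2 := [[dzero; (1%Z, 0%N)]].
Definition dx2 : poly2 -> poly2 := pderiv [] add1.
Definition dy2 : poly2 -> poly2 := map (pderiv dzero dadd).

Definition comp1 (p : list dyadic) (b : poly2) : poly2 :=
  fold_right (fun c r => add2 (const2 c) (mul2 b r)) [] p.
Definition comp2 (p a b : poly2) : poly2 :=
  fold_right (fun c r => add2 (comp1 c b) (mul2 a r)) [] p.

Lemma ev1_add (p q : list dyadic) (y : R) : ev1 (add1 p q) y = ev1 p y + ev1 q y.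
Proof. apply peval_add, dval_add. Qed.

Lemma ev1_mul (p q : list dyadic) (y : R) : ev1 (mul1 p q) y = ev1 p y * ev1 q y.
Proof. apply peval_mul; [apply dval_zero | apply dval_add | apply dval_mul]. Qed.

Lemma ev2_add (p q : poly2) (x y : R) : ev2 (add2 p q) x y = ev2 p x y + ev2 q x y.
Proof. apply (peval_add (fun c => ev1 c y)); intros; apply ev1_add. Qed.

Lemma ev2_mul (p q : poly2) (x y : R) : ev2 (mul2 p q) x y = ev2 p x y * ev2 q x y.
Proof.
  apply (peval_mul (fun c => ev1 c y)); intros;
    [reflexivity | apply ev1_add | apply ev1_mul].
Qed.

Lemma ev2_const (d : dyadic) (x y : R) : ev2 (const2 d) x y = dval d.
Proof. unfold ev2, ev1; simpl; ring. Qed.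

Lemma dval_int (n : Z) : dval (n, 0%N) = IZR n.
Proof. unfold dval; simpl; field. Qed.

Lemma ev2_int (n : Z) (x y : R) : ev2 (int2 n) x y = IZR n.
Proof. unfold int2; rewrite ev2_const; apply dval_int. Qed.

Lemma ev2_sub (p q : poly2) (x y : R) : ev2 (sub2 p q) x y = ev2 p x y - ev2 q x y.
Proof. unfold sub2; rewrite ev2_add, ev2_mul, ev2_int; ring. Qed.

Lemma ev2_X (x y : R) : ev2 X2 x y = x.
Proof. unfold ev2, ev1; simpl; rewrite dval_int; ring. Qed.

Lemma ev2_Y (x y : R) : ev2 Y2 x y = y.
Proof. unfold ev2, ev1; simpl; rewrite dval_int, dval_zero; ring. Qed.

Lemma ev2_comp1 (p : list dyadic) (b : poly2) (x y : R) :
  ev2 (comp1 p b) x y = ev1 p (ev2 b x y).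
Proof.
  induction p as [| c p IH]; [reflexivity |].
  cbn [comp1 fold_right]; fold (comp1 p b).
  rewrite ev2_add, ev2_const, ev2_mul, IH; reflexivity.
Qed.

Lemma ev2_comp2 (p a b : poly2) (x y : R) :
  ev2 (comp2 p a b) x y = ev2 p (ev2 a x y) (ev2 b x y).
Proof.
  induction p as [| c p IH]; [reflexivity |].
  cbn [comp2 fold_right]; fold (comp2 p a b).
  rewrite ev2_add, ev2_comp1, ev2_mul, IH; reflexivity.
Qed.

Lemma is_derive_horner (a g r : R -> R) (s da dg dr : R) :
  is_derive a s da -> is_derive g s dg -> is_derive r s dr ->
  is_derive (fun s => a s + g s * r s) s (da + (dg * r s + g s * dr)).
Proof.
  intros Ha Hg Hr; apply (is_derive_plus a (fun s => g s * r s)); [exact Ha |].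
  apply (is_derive_mult g r); [exact Hg | exact Hr | exact Rmult_comm].
Qed.

Lemma ev1_derive (p : list dyadic) (h : R -> R) (s dh : R) :
  is_derive h s dh ->
  is_derive (fun s => ev1 p (h s)) s (dh * ev1 (pderiv dzero dadd p) (h s)).
Proof.
  intros Hh; induction p as [| c p IH].
  - rewrite Rmult_0_r; apply (is_derive_const (0 : R)).
  - cbn [pderiv]; fold (add1 p (dzero :: pderiv dzero dadd p)); rewrite ev1_add.
    replace (dh * _)
      with (0 + (dh * ev1 p (h s) + h s * (dh * ev1 (pderiv dzero dadd p) (h s))))
      by (unfold ev1; simpl; rewrite dval_zero; ring).
    apply (is_derive_horner (fun _ => dval c) h (fun s => ev1 p (h s)));
      [apply (is_derive_const (dval c)) | exact Hh | exact IH].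
Qed.

Lemma ev2_derive (p : poly2) (g h : R -> R) (s dg dh : R) :
  is_derive g s dg -> is_derive h s dh ->
  is_derive (fun s => ev2 p (g s) (h s)) s
    (dg * ev2 (dx2 p) (g s) (h s) + dh * ev2 (dy2 p) (g s) (h s)).
Proof.
  intros Hg Hh; induction p as [| c p IH].
  - replace (_ + _) with 0 by (unfold ev2; simpl; ring); apply (is_derive_const (0 : R)).
  - unfold dx2; cbn [pderiv dy2 map]; fold (dx2 p).
    fold (add2 p ([] :: dx2 p)); rewrite ev2_add.
    match goal with |- is_derive _ _ ?d => replace d with
      (dh * ev1 (pderiv dzero dadd c) (h s) +
       (dg * ev2 p (g s) (h s) +
        g s * (dg * ev2 (dx2 p) (g s) (h s) + dh * ev2 (dy2 p) (g s) (h s))))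
      by (unfold ev2, dy2; simpl; unfold ev1; simpl; ring) end.
    apply (is_derive_horner (fun s => ev1 c (h s)) g (fun s => ev2 p (g s) (h s)));
      [apply ev1_derive, Hh | exact Hg | exact IH].
Qed.

(** * Certified positivity on rectangles by subdivision *)

(* The conditional (instead of [||]) keeps call-by-value evaluation from unfolding the whole tree. *)
Fixpoint subdivide_pos (n : nat) (split_x : bool) (p : poly2) : bool :=
  if ppos add1 (ppos dadd dpos) p then true else
  match n with
  | O => false
  | S n =>
      if split_x then
        let l := pscale_half (map dhalf) p in
        subdivide_pos n false l && subdivide_pos n false (pshift add1 l)
      else
        let l := map (pscale_half dhalf) p in
        subdivide_pos n true l && subdivide_pos n true (map (pshift dadd) l)
  end.

Definition dsub (a b : dyadic) : dyadic := dadd a (dmul ((-1)%Z, 0%N) b).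

Definition floor2 (k : N) (p : poly2) : poly2 := map (map (dfloor k)) p.

(* Substitutes [x0 + dx u] and [y0 + dy v], rounding coefficients down along the way. *)
Definition rescale (k : N) (p : poly2) (x0 x1 y0 y1 : dyadic) : poly2 :=
  let a := [[x0]; [dsub x1 x0]] in
  let b := [[y0; dsub y1 y0]] in
  fold_right (fun c r => floor2 k (add2 (comp1 c b) (mul2 a r))) [] p.

(** [n] bounds the number of bisections and [k] the fractional bits kept. The rectangle is
    half-open, without its left and lower sides. *)
Definition pos_on (n : nat) (k : N) (p : poly2) (x0 x1 y0 y1 : dyadic) : bool :=
  (0 <=? fst x0)%Z && dpos (dsub x1 x0) && dpos (dsub y1 y0) &&
  subdivide_pos n true (rescale k p x0 x1 y0 y1).

Lemma dval_sub (a b : dyadic) : dval (dsub a b) = dval a - dval b.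
Proof. unfold dsub; rewrite dval_add, dval_mul, dval_int; ring. Qed.

Lemma ev2_map (f : list dyadic -> list dyadic) (g : R -> R)
    (Hf : forall c y, ev1 (f c) y = ev1 c (g y)) (p : poly2) (x y : R) :
  ev2 (map f p) x y = ev2 p x (g y).
Proof. induction p as [| c p IH]; unfold ev2 in *; simpl; [| rewrite Hf, IH]; reflexivity. Qed.

Lemma ev1_map_half (c : list dyadic) (y : R) : ev1 (map dhalf c) y = ev1 c y / 2.
Proof.
  unfold ev1; rewrite (peval_map dval dhalf (/ 2)); [field |].
  intros; rewrite dval_half; field.
Qed.

(** The interval (0, 1] is exactly the union of its images under u -> u/2 and u -> (1 + u)/2. On
    each cell the test is a tensor one: the coefficients in the first variable are tested as
    polynomials in the second. *)
Lemma subdivide_pos_sound (n : nat) (sx : bool) (p : poly2) (x y : R) :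
  subdivide_pos n sx p = true -> 0 < x <= 1 -> 0 < y <= 1 -> 0 < ev2 p x y.
Proof.
  revert sx p x y; induction n as [| n IH]; intros sx p x y H Hx Hy;
    cbn [subdivide_pos] in H; destruct (ppos add1 (ppos dadd dpos) p) eqn:Hp.
  1, 3: apply (ppos_sound (fun c => ev1 c y) add1 (ppos dadd dpos)); auto;
    [intros; apply ev1_add |
     intros c Hc; apply (ppos_sound dval dadd dpos dval_add dval_pos); assumption].
  - discriminate.
  - destruct sx; apply andb_prop in H; destruct H as [Hl Hr].
    + assert (El : forall u, ev2 (pscale_half (map dhalf) p) u y = ev2 p (u / 2) y)
        by (intros; apply (peval_scale_half (fun c => ev1 c y)); intros; apply ev1_map_half).
      destruct (Rle_or_lt x (1 / 2)) as [Hx2 | Hx2].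
      * replace x with ((2 * x) / 2) by field; rewrite <- El.
        apply (IH false); try assumption; lra.
      * replace x with ((1 + (2 * x - 1)) / 2) by field; rewrite <- El.
        unfold ev2; rewrite <- (peval_shift (fun c => ev1 c y) add1)
          by (intros; apply ev1_add).
        apply (IH false _ (2 * x - 1) y); try assumption; lra.
    + assert (El : forall v, ev2 (map (pscale_half dhalf) p) x v = ev2 p x (v / 2))
        by (intros; apply (ev2_map _ (fun y => y / 2)); intros;
            apply (peval_scale_half dval), dval_half).
      destruct (Rle_or_lt y (1 / 2)) as [Hy2 | Hy2].
      * replace y with ((2 * y) / 2) by field; rewrite <- El.
        apply (IH true); try assumption; lra.
      * replace y with ((1 + (2 * y - 1)) / 2) by field; rewrite <- El.
        rewrite <- (ev2_map (pshift dadd) (fun y => 1 + y))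
          by (intros; apply (peval_shift dval), dval_add).
        apply (IH true); try assumption; lra.
Qed.

Lemma peval_le {A : Type} (ev : A -> R) (f : A -> A)
    (Hf : forall a, ev (f a) <= ev a) (p : list A) (x : R) :
  0 <= x -> peval ev (map f p) x <= peval ev p x.
Proof.
  intros Hx; induction p as [| a p IH]; simpl; [lra |].
  pose proof (Hf a); nra.
Qed.

Lemma ev2_floor (k : N) (p : poly2) (x y : R) :
  0 <= x -> 0 <= y -> ev2 (floor2 k p) x y <= ev2 p x y.
Proof.
  intros Hx Hy; apply (peval_le (fun c => ev1 c y)); [| exact Hx].
  intros c; apply (peval_le dval); [apply dval_floor | exact Hy].
Qed.

(** The rounded remainder is multiplied by x0 + (x1 - x0) u, so this factor must be nonnegative for
    the error to keep its direction. The value y0 may be negative, because the coefficients in y are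
    substituted exactly before rounding. *)
Lemma ev2_rescale (k : N) (p : poly2) (x0 x1 y0 y1 : dyadic) (u v : R) :
  0 <= dval x0 -> dval x0 <= dval x1 -> 0 <= u -> 0 <= v ->
  ev2 (rescale k p x0 x1 y0 y1) u v <=
  ev2 p (dval x0 + (dval x1 - dval x0) * u) (dval y0 + (dval y1 - dval y0) * v).
Proof.
  intros H0 H1 Hu Hv; induction p as [| c p IH]; [apply Rle_refl |].
  unfold rescale; cbn [fold_right].
  fold (rescale k p x0 x1 y0 y1).
  eapply Rle_trans; [apply ev2_floor; assumption |].
  rewrite ev2_add, ev2_comp1, ev2_mul.
  replace (ev2 [[y0; dsub y1 y0]] u v) with (dval y0 + (dval y1 - dval y0) * v)
    by (unfold ev2, ev1; simpl; rewrite dval_sub; ring).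
  replace (ev2 [[x0]; [dsub x1 x0]] u v) with (dval x0 + (dval x1 - dval x0) * u)
    by (unfold ev2, ev1; simpl; rewrite dval_sub; ring).
  apply Rplus_le_compat_l, Rmult_le_compat_l; [nra | exact IH].
Qed.

Lemma pos_on_sound (n : nat) (k : N) (p : poly2) (x0 x1 y0 y1 : dyadic) (x y : R) :
  pos_on n k p x0 x1 y0 y1 = true ->
  dval x0 < x <= dval x1 -> dval y0 < y <= dval y1 -> 0 < ev2 p x y.
Proof.
  assert (Hunit : forall a b t, 0 < b - a -> a < t <= b -> 0 < (t - a) / (b - a) <= 1).
  { intros a b t Hab Ht; split; [apply Rdiv_lt_0_compat; lra |].
    apply (Rmult_le_reg_r (b - a)); [lra |]; field_simplify; lra. }
  unfold pos_on; intros H Hx Hy.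
  apply andb_prop in H; destruct H as [H Hc]; apply andb_prop in H; destruct H as [H Dy];
    apply andb_prop in H; destruct H as [Hx0 Dx].
  apply dval_pos in Dx; apply dval_pos in Dy; rewrite dval_sub in Dx, Dy.
  assert (P0 : 0 <= dval x0).
  { apply Z.leb_le, IZR_le in Hx0; apply Rmult_le_pos; [exact Hx0 |].
    left; apply Rinv_0_lt_compat, pow2_pos. }
  pose proof (subdivide_pos_sound _ _ _ _ _ Hc (Hunit _ _ _ Dx Hx) (Hunit _ _ _ Dy Hy)) as P.
  eapply Rlt_le_trans; [exact P |].
  eapply Rle_trans; [apply ev2_rescale; try lra; left; apply Hunit; lra |].
  apply Req_le; f_equal; field; lra.
Qed.

(** * Differential inequalities *)

Lemma continuous_pos (phi : R -> R) (c : R) :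
  continuous phi c -> 0 < phi c ->
  exists d, 0 < d /\ forall y, Rabs (y - c) < d -> 0 < phi y.
Proof.
  intros Hc Hp.
  assert (H : locally c (fun y => 0 < phi y))
    by (apply Hc; apply (open_gt 0 (phi c)), Hp).
  destruct H as [d Hd]; exists d; split; [apply cond_pos |].
  intros y Hy; apply Hd, Hy.
Qed.

(** Let c be the supremum of the times up to which phi stays positive. Continuity excludes phi c <
    0, the last hypothesis excludes phi c = 0, and phi c > 0 would let the interval be extended
    beyond c. *)
Lemma positive_continuation (phi : R -> R) (a b : R) :
  (forall x, a <= x <= b -> continuous phi x) -> 0 < phi a ->
  (forall c, a < c <= b -> (forall x, a <= x < c -> 0 < phi x) -> phi c <> 0) ->
  forall x, a <= x <= b -> 0 < phi x.
Proof.
  intros Hcont Ha Hstep x Hx.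
  destruct (Rlt_or_le 0 (phi x)) as [H | Hneg]; [exact H | exfalso].
  set (E t := a <= t <= x /\ forall y, a <= y <= t -> 0 < phi y).
  assert (HEa : E a) by (split; [lra | intros y Hy; replace y with a by lra; exact Ha]).
  destruct (completeness E) as [c [Hub Hlub]].
  { exists x; intros t [Ht _]; lra. }
  { exists a; exact HEa. }
  assert (Hac : a <= c) by (apply Hub, HEa).
  assert (Hcx : c <= x) by (apply Hlub; intros t [Ht _]; lra).
  assert (Hbelow : forall y, a <= y < c -> 0 < phi y).
  { intros y Hy; destruct (Rlt_or_le 0 (phi y)) as [H | H]; [exact H | exfalso].
    assert (c <= y); [| lra].
    apply Hlub; intros t [Ht Hpos]; apply Rnot_lt_le; intros Hyt.
    specialize (Hpos y ltac:(lra)); lra. }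
  destruct (Rtotal_order (phi c) 0) as [Hc | [Hc | Hc]].
  - destruct (continuous_pos (fun y => - phi y) c) as [d [Hd Hnear]]; [| lra |].
    { apply (continuous_opp phi), Hcont; lra. }
    assert (Hne : a <> c) by (intros E0; rewrite <- E0 in Hc; lra).
    set (y := Rmax a (c - d / 2)).
    assert (a <= y < c /\ c - d / 2 <= y)
      by (unfold y; apply Rmax_case_strong; intros; lra).
    specialize (Hnear y ltac:(apply Rabs_def1; lra)).
    specialize (Hbelow y ltac:(lra)); lra.
  - assert (Hne : a <> c) by (intros E0; rewrite <- E0 in Hc; lra).
    apply (Hstep c); [lra | exact Hbelow | exact Hc].
  - destruct (continuous_pos phi c) as [d [Hd Hnear]]; [apply Hcont; lra | exact Hc |].
    assert (Hlt : c < x) by (apply Rnot_le_lt; intros ?; replace x with c in Hneg by lra; lra).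
    set (t := Rmin x (c + d / 2)).
    assert (Ht : c < t <= x /\ t <= c + d / 2)
      by (unfold t; apply Rmin_case_strong; intros; lra).
    assert (HEt : E t).
    { split; [lra |]; intros y Hy.
      destruct (Rlt_or_le y c) as [Hyc | Hyc]; [apply Hbelow; lra |].
      apply Hnear, Rabs_def1; lra. }
    specialize (Hub t HEt); lra.
Qed.

Lemma derive_pos_left (phi : R -> R) (c l d : R) :
  is_derive phi c l -> 0 < l -> 0 < d ->
  exists y, c - d <= y < c /\ phi y < phi c.
Proof.
  intros Hphi Hl Hd; apply is_derive_Reals in Hphi.
  destruct (Hphi l Hl) as [e He].
  pose proof (cond_pos e) as He0.
  set (h := Rmin d (e / 2)).
  assert (Hh : 0 < h <= d /\ h < e)
    by (unfold h; apply Rmin_case_strong; intros; lra).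
  exists (c - h); split; [lra |].
  specialize (He (- h) ltac:(lra) ltac:(rewrite Rabs_Ropp, Rabs_right; lra)).
  apply Rabs_def2 in He; destruct He as [_ He].
  assert (Hq : 0 < (phi (c + - h) - phi c) / - h) by lra.
  replace (c - h) with (c + - h) by ring.
  assert (E : phi (c + - h) - phi c = (phi (c + - h) - phi c) / - h * - h) by (field; lra).
  nra.
Qed.

(** At a first zero the derivative would be positive, so phi would already be negative just before
    it. The sign of the derivative is thus required only where phi vanishes. *)
Lemma strict_barrier (phi dphi : R -> R) (a b : R) :
  (forall x, a <= x <= b -> is_derive phi x (dphi x)) -> 0 < phi a ->
  (forall x, a < x <= b -> phi x = 0 -> 0 < dphi x) ->
  forall x, a <= x <= b -> 0 < phi x.
Proof.
  intros Hder Ha Hdir.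
  apply positive_continuation; [| exact Ha |].
  - intros x Hx; apply (ex_derive_continuous (V := R_NormedModule) phi); eexists; apply Hder, Hx.
  - intros c Hc Hpos Hzero.
    destruct (derive_pos_left phi c (dphi c) (c - a)) as [y [Hy Hlt]];
      [apply Hder; lra | apply Hdir; assumption | lra |].
    specialize (Hpos y ltac:(lra)); lra.
Qed.

Lemma mean_value (f df : R -> R) (a b : R) :
  a < b -> (forall x, a <= x <= b -> is_derive f x (df x)) ->
  exists c, a <= c <= b /\ f b - f a = df c * (b - a).
Proof.
  intros Hab Hder.
  destruct (MVT_gen f a b df) as [c [Hc E]].
  - intros x Hx; rewrite Rmin_left, Rmax_right in Hx by lra; apply Hder; lra.
  - intros x Hx; rewrite Rmin_left, Rmax_right in Hx by lra.
    apply derivable_continuous_pt; exists (df x); apply is_derive_Reals, Hder; lra.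
  - rewrite Rmin_left, Rmax_right in Hc by lra; exists c; split; assumption.
Qed.

Lemma growth_lower_bound (f df : R -> R) (a b m : R) :
  a <= b -> (forall x, a <= x <= b -> is_derive f x (df x)) ->
  (forall x, a <= x <= b -> m <= df x) -> f a + m * (b - a) <= f b.
Proof.
  intros [Hab | <-] Hder Hm; [| lra].
  destruct (mean_value f df a b Hab Hder) as [c [Hc E]].
  specialize (Hm c Hc); nra.
Qed.

Lemma growth_upper_bound (f df : R -> R) (a b m : R) :
  a <= b -> (forall x, a <= x <= b -> is_derive f x (df x)) ->
  (forall x, a <= x <= b -> df x <= m) -> f b <= f a + m * (b - a).
Proof.
  intros [Hab | <-] Hder Hm; [| lra].
  destruct (mean_value f df a b Hab Hder) as [c [Hc E]].
  specialize (Hm c Hc); nra.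
Qed.

(** * Limits at the origin *)

Lemma filterlim_Rplus {F : (R -> Prop) -> Prop} {FF : Filter F} (f g : R -> R) (a b : R) :
  filterlim f F (locally a) -> filterlim g F (locally b) ->
  filterlim (fun x => f x + g x) F (locally (a + b)).
Proof. intros Hf Hg; exact (filterlim_comp_2 f g Rplus Hf Hg (filterlim_plus a b)). Qed.

Lemma filterlim_Rmult {F : (R -> Prop) -> Prop} {FF : Filter F} (f g : R -> R) (a b : R) :
  filterlim f F (locally a) -> filterlim g F (locally b) ->
  filterlim (fun x => f x * g x) F (locally (a * b)).
Proof. intros Hf Hg; exact (filterlim_comp_2 f g Rmult Hf Hg (filterlim_mult a b)). Qed.

Lemma ev2_lim {F : (R -> Prop) -> Prop} {FF : Filter F} (p : poly2) (g h : R -> R) (x y : R) :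
  filterlim g F (locally x) -> filterlim h F (locally y) ->
  filterlim (fun s => ev2 p (g s) (h s)) F (locally (ev2 p x y)).
Proof.
  intros Hg Hh.
  assert (H1 : forall c, filterlim (fun s => ev1 c (h s)) F (locally (ev1 c y))).
  { intros c; induction c as [| d c IH]; [apply filterlim_const |].
    apply filterlim_Rplus; [apply filterlim_const | apply filterlim_Rmult; assumption]. }
  induction p as [| c p IH]; [apply filterlim_const |].
  apply filterlim_Rplus; [apply H1 | apply filterlim_Rmult; assumption].
Qed.

Lemma at_right_elim (P : R -> Prop) :
  at_right 0 P -> exists d, 0 < d /\ forall s, 0 < s < d -> P s.
Proof.
  intros [d Hd]; exists d; split; [apply cond_pos |].
  intros s Hs; apply Hd; [| lra].
  unfold ball; simpl; unfold AbsRing_ball, abs, minus, plus, opp; simpl.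
  apply Rabs_def1; lra.
Qed.

Lemma lim_right_pos (f : R -> R) (l : R) :
  filterlim f (at_right 0) (locally l) -> 0 < l ->
  exists d, 0 < d /\ forall s, 0 < s < d -> 0 < f s.
Proof. intros Hf Hl; apply at_right_elim, Hf, (open_gt 0 l), Hl. Qed.

Lemma lim_right_close (f : R -> R) (l e : R) :
  filterlim f (at_right 0) (locally l) -> 0 < e ->
  exists d, 0 < d /\ forall s, 0 < s < d -> Rabs (f s - l) < e.
Proof.
  intros Hf He; apply (at_right_elim (fun s => Rabs (f s - l) < e)).
  apply (Hf (fun y => Rabs (y - l) < e)).
  exists (mkposreal e He); intros y Hy; exact Hy.
Qed.

(** Where r is within eps of c, the functions e s^2 g - (e c + eps) s^3/3 with e = 1 or e = -1 are
    nonincreasing and tend to 0 at the origin. Hence they are nonpositive, and dividing by s^3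
    bounds the error by eps/3. *)
Lemma lim_of_flux (g r : R -> R) (c : R) :
  (forall s, 0 < s -> is_derive (fun s => s ^ 2 * g s) s (s ^ 2 * r s)) ->
  filterlim g (at_right 0) (locally 0) -> filterlim r (at_right 0) (locally c) ->
  filterlim (fun s => g s / s) (at_right 0) (locally (c / 3)).
Proof.
  intros Hder Hg Hr.
  apply filterlim_locally; intros eps.
  destruct (lim_right_close r c eps Hr (cond_pos eps)) as [d1 [Hd1 H1]].
  destruct (lim_right_close g 0 1 Hg Rlt_0_1) as [d2 [Hd2 H2]].
  exists (mkposreal (Rmin d1 d2) (Rmin_pos _ _ Hd1 Hd2)); intros s Hs Hs0.
  assert (Hs1 : s < d1 /\ s < d2).
  { unfold ball in Hs; simpl in Hs; unfold AbsRing_ball, abs, minus, plus, opp in Hs.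
    simpl in Hs; apply Rabs_def2 in Hs.
    pose proof (Rmin_l d1 d2); pose proof (Rmin_r d1 d2); lra. }
  (* Stands in for the passage to the limit t -> 0. *)
  assert (Hsmall : forall k, 0 <= k -> forall u, (forall t, 0 < t < s -> u <= k * t ^ 2) -> u <= 0).
  { intros k Hk u Hu; apply Rnot_lt_le; intros Hu0.
    set (t := Rmin (s / 2) (u / (2 * (k * s + 1)))).
    assert (Hden : 0 < 2 * (k * s + 1)) by nra.
    assert (Hq : 0 < u / (2 * (k * s + 1))) by (apply Rdiv_lt_0_compat; lra).
    assert (Ht : 0 < t <= s / 2 /\ t <= u / (2 * (k * s + 1)))
      by (unfold t; apply Rmin_case_strong; intros; lra).
    specialize (Hu t ltac:(lra)).
    assert (Hmul : t * (2 * (k * s + 1)) <= u).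
    { replace u with (u / (2 * (k * s + 1)) * (2 * (k * s + 1))) by (field; lra).
      apply Rmult_le_compat_r; lra. }
    assert (k * t ^ 2 <= k * s * t) by (simpl; assert (0 <= k * t) by nra; nra).
    nra. }
  assert (Hone : forall e, (e = 1 \/ e = -1) -> e * (g s / s - c / 3) <= eps / 3).
  { intros e He.
    assert (Hu : e * (s ^ 2 * g s) - (e * c + eps) * s ^ 3 / 3 <= 0).
    { apply (Hsmall (1 + Rabs (e * c + eps) * s));
        [pose proof (Rabs_pos (e * c + eps)); nra |].
      intros t Ht.
      assert (Hdec : e * (s ^ 2 * g s) - (e * c + eps) * s ^ 3 / 3 <=
              e * (t ^ 2 * g t) - (e * c + eps) * t ^ 3 / 3 + 0 * (s - t)).
      { apply (growth_upper_bound
          (fun x => e * (x ^ 2 * g x) - (e * c + eps) * x ^ 3 / 3)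
          (fun x => e * (x ^ 2 * r x) - (e * c + eps) * x ^ 2)); [lra | |].
        - intros x Hx.
          apply (is_derive_minus (fun x => e * (x ^ 2 * g x))
                   (fun x => (e * c + eps) * x ^ 3 / 3)).
          + apply (is_derive_scal (fun x => x ^ 2 * g x)), Hder; lra.
          + auto_derive; [exact I | field].
        - intros x Hx; specialize (H1 x ltac:(lra)); apply Rabs_def2 in H1.
          assert (0 < x ^ 2) by (apply pow_lt; lra).
          destruct He as [-> | ->]; nra. }
      specialize (H2 t ltac:(lra)); rewrite Rminus_0_r in H2; apply Rabs_def2 in H2.
      assert (0 < t ^ 2) by (apply pow_lt; lra).
      assert (e * (t ^ 2 * g t) <= t ^ 2) by (destruct He as [-> | ->]; nra).
      assert (- ((e * c + eps) * t ^ 3 / 3) <= Rabs (e * c + eps) * s * t ^ 2).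
      { pose proof (Rle_abs (- (e * c + eps))) as Ha; rewrite Rabs_Ropp in Ha.
        pose proof (Rabs_pos (e * c + eps)).
        replace (t ^ 3) with (t * t ^ 2) by ring.
        assert (0 < t * t ^ 2) by nra.
        assert (- (e * c + eps) * (t * t ^ 2) <= Rabs (e * c + eps) * (t * t ^ 2))
          by (apply Rmult_le_compat_r; lra).
        assert (0 <= Rabs (e * c + eps) * t ^ 2) by nra.
        nra. }
      nra. }
    assert (Hs3 : 0 < s ^ 3) by (apply pow_lt; lra).
    assert (E : e * (s ^ 2 * g s) - (e * c + eps) * s ^ 3 / 3 =
                s ^ 3 * (e * (g s / s - c / 3) - eps / 3)) by (field; lra).
    rewrite E in Hu; nra. }
  pose proof (Hone 1 (or_introl eq_refl)) as Hp.
  pose proof (Hone (-1) (or_intror eq_refl)) as Hm.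
  pose proof (cond_pos eps).
  change (Rabs (g s / s - c / 3) < eps); apply Rabs_def1; lra.
Qed.

(** * Ground-state profiles *)

Record profile (Q Q1 : R -> R) : Prop := {
  profile_pos : forall s, 0 <= s -> 0 < Q s;
  profile_d1 : forall s, 0 < s -> is_derive Q s (Q1 s);
  profile_d2 : forall s, 0 < s -> is_derive Q1 s (- (2 / s) * Q1 s + Q s - Q s ^ 3);
  profile_lim0 : filterlim Q (at_right 0) (locally (Q 0));
  profile_d1_lim0 : filterlim Q1 (at_right 0) (locally 0);
  profile_lim_infty : filterlim Q (Rbar_locally p_infty) (locally 0)
}.

Ltac rewrite_derive H :=
  match type of H with
  | is_derive _ _ ?l =>
      repeat match goal with
      | |- context [Derive ?g ?y] =>
          replace (Derive g y) with l by (symmetry; apply is_derive_unique; exact H)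
      end
  end.

Ltac derive_with HD1 HD2 :=
  auto_derive;
  [repeat split; try (eexists; first [exact HD1 | exact HD2]); auto; try lra |
   rewrite_derive HD1; rewrite_derive HD2].

Lemma profile_small (Q Q1 : R -> R) (h : profile Q Q1) (e a : R) :
  0 < e -> exists S, a < S /\ forall s, S <= s -> 0 < s /\ Q s < e.
Proof.
  intros He.
  assert (H : Rbar_locally p_infty (fun s => Q s < e))
    by (apply (profile_lim_infty _ _ h (fun y => y < e)), (open_lt e 0), He).
  destruct H as [M HM].
  exists (Rmax (Rmax M a) 0 + 1).
  pose proof (Rmax_l (Rmax M a) 0); pose proof (Rmax_r (Rmax M a) 0);
    pose proof (Rmax_l M a); pose proof (Rmax_r M a).
  split; [lra |]; intros s Hs; split; [lra | apply HM; lra].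
Qed.

(** The friction term makes the energy nonincreasing, with derivative -2 Q'^2/s. A negative value
    would persist, against the lower bound -Q^2/2, which tends to 0. *)
Lemma energy_nonneg (Q Q1 : R -> R) (h : profile Q Q1) (s : R) :
  0 < s -> 0 <= Q1 s ^ 2 / 2 + Q s ^ 4 / 4 - Q s ^ 2 / 2.
Proof.
  intros Hs; apply Rnot_lt_le; intros Hneg.
  set (E x := Q1 x ^ 2 / 2 + Q x ^ 4 / 4 - Q x ^ 2 / 2) in *.
  assert (Hneg' : E s < 0) by exact Hneg.
  destruct (profile_small Q Q1 h (Rmin 1 (- E s)) s) as [S [HS Hsmall]];
    [apply Rmin_pos; lra |].
  destruct (Hsmall S (Rle_refl S)) as [HS0 HQ].
  pose proof (Rmin_l 1 (- E s)); pose proof (Rmin_r 1 (- E s)).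
  pose proof (profile_pos _ _ h S ltac:(lra)).
  assert (Hdec : E S <= E s + 0 * (S - s)).
  { apply (growth_upper_bound E (fun x => - (2 / x) * Q1 x ^ 2)); [lra | |].
    - intros x Hx.
      pose proof (profile_d1 _ _ h x ltac:(lra)) as HD1.
      pose proof (profile_d2 _ _ h x ltac:(lra)) as HD2.
      unfold E; derive_with HD1 HD2; field; lra.
    - intros x Hx; assert (0 < 2 / x) by (apply Rdiv_lt_0_compat; lra).
      pose proof (pow2_ge_0 (Q1 x)); nra. }
  unfold E at 1 in Hdec; pose proof (pow2_ge_0 (Q1 S)).
  assert (0 <= Q S ^ 4) by (apply pow_le; lra).
  nra.
Qed.

(* [F = f'^2 - f^2 + f^4 / (2 s^2)] for [f = s Q] satisfies [F' = - f^4 / s^3]. *)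
Lemma flux_nonneg (Q Q1 : R -> R) (h : profile Q Q1) (s : R) :
  0 < s -> 0 <= (Q s + s * Q1 s) ^ 2 - s ^ 2 * Q s ^ 2 + s ^ 2 * Q s ^ 4 / 2.
Proof.
  intros Hs; apply Rnot_lt_le; intros Hneg.
  set (F x := (Q x + x * Q1 x) ^ 2 - x ^ 2 * Q x ^ 2 + x ^ 2 * Q x ^ 4 / 2) in *.
  assert (Hneg' : F s < 0) by exact Hneg.
  (* F stays at most -m^2 beyond s, and F >= -f^2, so f >= m from then on. *)
  set (m := sqrt (- F s)).
  assert (Hm : 0 < m) by (apply sqrt_lt_R0; lra).
  assert (Hm2 : m * m = - F s) by (apply sqrt_sqrt; lra).
  destruct (profile_small Q Q1 h (1 / 2) s) as [S [HS Hsmall]]; [lra |].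
  assert (HS0 : 0 < S) by (apply (Hsmall S); lra).
  assert (Hf : forall x, S <= x -> m <= x * Q x).
  { intros x Hx.
    assert (Hdec : F x <= F s + 0 * (x - s)).
    { apply (growth_upper_bound F (fun x => - (x * Q x ^ 4))); [lra | |].
      - intros y Hy.
        pose proof (profile_d1 _ _ h y ltac:(lra)) as HD1.
        pose proof (profile_d2 _ _ h y ltac:(lra)) as HD2.
        unfold F; derive_with HD1 HD2; field; lra.
      - intros y Hy; pose proof (pow_lt (Q y) 4 (profile_pos _ _ h y ltac:(lra))); nra. }
    pose proof (profile_pos _ _ h x ltac:(lra)).
    unfold F at 1 in Hdec.
    pose proof (pow2_ge_0 (Q x + x * Q1 x)).
    assert (0 <= x ^ 2 * Q x ^ 4) by (apply Rmult_le_pos; apply pow_le; lra).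
    assert (m * m <= (x * Q x) * (x * Q x)) by (rewrite Hm2; nra).
    assert (0 <= x * Q x) by nra.
    nra. }
  (* f'' = (1 - Q^2) f >= m/2 as soon as Q < 1/2, so f' grows at least linearly and f at least
     quadratically, which is incompatible with f < s/2. *)
  assert (Hf1 : forall x, S <= x -> Q S + S * Q1 S + m / 2 * (x - S) <= Q x + x * Q1 x).
  { intros x Hx.
    apply (growth_lower_bound (fun x => Q x + x * Q1 x)
             (fun x => (1 - Q x ^ 2) * (x * Q x))); [lra | |].
    - intros y Hy.
      pose proof (profile_d1 _ _ h y ltac:(lra)) as HD1.
      pose proof (profile_d2 _ _ h y ltac:(lra)) as HD2.
      derive_with HD1 HD2; field; lra.
    - intros y Hy; destruct (Hsmall y ltac:(lra)) as [Hy0 HQ].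
      pose proof (profile_pos _ _ h y ltac:(lra)).
      specialize (Hf y ltac:(lra)).
      assert (1 / 2 <= 1 - Q y ^ 2) by nra.
      nra. }
  set (k := Q S + S * Q1 S) in *.
  assert (Hquad : forall x, S <= x -> S * Q S + k * (x - S) + m / 4 * (x - S) ^ 2 <= x * Q x).
  { intros x Hx.
    pose proof (growth_lower_bound (fun x => x * Q x - k * (x - S) - m / 4 * (x - S) ^ 2)
      (fun x => Q x + x * Q1 x - k - m / 2 * (x - S)) S x 0 Hx) as G.
    cbv beta in G; rewrite Rmult_0_l in G.
    enough (S * Q S - k * (S - S) - m / 4 * (S - S) ^ 2 + 0 <=
            x * Q x - k * (x - S) - m / 4 * (x - S) ^ 2) by nra.
    apply G.
    - intros y Hy.
      pose proof (profile_d1 _ _ h y ltac:(lra)) as HD1.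
      derive_with HD1 HD1; field.
    - intros y Hy; specialize (Hf1 y ltac:(lra)); lra. }
  (* at this distance the quadratic lower bound of [x Q x] exceeds [x] *)
  set (d := (4 * (1 + Rabs k) / m) + S).
  assert (Hq : 0 < 4 * (1 + Rabs k) / m)
    by (apply Rdiv_lt_0_compat; [pose proof (Rabs_pos k) |]; lra).
  assert (Hd : m * d = 4 * (1 + Rabs k) + m * S) by (unfold d; field; lra).
  assert (0 < d) by (unfold d; lra).
  specialize (Hquad (S + d) ltac:(lra)).
  destruct (Hsmall (S + d) ltac:(lra)) as [_ HQ].
  pose proof (profile_pos _ _ h S ltac:(lra)).
  replace (S + d - S) with d in Hquad by ring.
  pose proof (Rle_abs (- k)) as Hk; rewrite Rabs_Ropp in Hk.
  assert (Hmd : m / 4 * d ^ 2 = (1 + Rabs k) * d + m * S * d / 4)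
    by (replace (m / 4 * d ^ 2) with (m * d * d / 4) by field; rewrite Hd; field).
  assert (0 <= m * S * d) by (apply Rmult_le_pos; nra).
  assert (d > S) by (unfold d; lra).
  assert (0 <= (Rabs k + k) * d) by (apply Rmult_le_pos; lra).
  nra.
Qed.

(* [e^{-s} (f' + f)] is nonincreasing for [f = s Q], so [f' + f < 0] would force [f] to vanish. *)
Lemma decay_rate_bound (Q Q1 : R -> R) (h : profile Q Q1) (s : R) :
  0 < s -> 0 <= Q s + s * Q1 s + s * Q s.
Proof.
  intros Hs; apply Rnot_lt_le; intros Hneg.
  set (g x := Q x + x * Q1 x + x * Q x) in *.
  assert (Hneg' : g s < 0) by exact Hneg.
  assert (Hg : forall x, s <= x -> g x <= g s).
  { intros x Hx.
    assert (Hdec : exp (- x) * g x <= exp (- s) * g s + 0 * (x - s)).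
    { apply (growth_upper_bound (fun x => exp (- x) * g x)
               (fun x => - (exp (- x) * (Q x ^ 2 * (x * Q x))))); [lra | |].
      - intros y Hy.
        pose proof (profile_d1 _ _ h y ltac:(lra)) as HD1.
        pose proof (profile_d2 _ _ h y ltac:(lra)) as HD2.
        unfold g; derive_with HD1 HD2; field; lra.
      - intros y Hy; pose proof (exp_pos (- y)).
        pose proof (profile_pos _ _ h y ltac:(lra)).
        assert (0 <= Q y ^ 2 * (y * Q y))
          by (apply Rmult_le_pos; [apply pow2_ge_0 | nra]).
        nra. }
    assert (Hexp : exp (- x) <= exp (- s))
      by (destruct Hx as [Hx | ->]; [left; apply exp_increasing; lra | lra]).
    pose proof (exp_pos (- x)).
    nra. }
  pose proof (profile_pos _ _ h s ltac:(lra)) as HQs.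
  (* Beyond s the slope f' is at most g s < 0, so f would be nonpositive at s + d. *)
  set (d := s * Q s / - g s).
  assert (Hd : 0 < d) by (apply Rdiv_lt_0_compat; nra).
  assert (Hf : (s + d) * Q (s + d) <= s * Q s + g s * (s + d - s)).
  { apply (growth_upper_bound (fun x => x * Q x) (fun x => Q x + x * Q1 x)); [lra | |].
    - intros y Hy; pose proof (profile_d1 _ _ h y ltac:(lra)) as HD1.
      derive_with HD1 HD1; ring.
    - intros y Hy; specialize (Hg y ltac:(lra)).
      pose proof (profile_pos _ _ h y ltac:(lra)); unfold g at 1 in Hg; nra. }
  replace (g s * (s + d - s)) with (- (s * Q s)) in Hf by (unfold d; field; lra).
  pose proof (profile_pos _ _ h (s + d) ltac:(lra)); nra.
Qed.

(** * Logarithmic variables *)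

(* The variables [z] and [Y]. *)
Definition zeta (Q Q1 : R -> R) (s : R) : R := - (s * Q1 s) / Q s.
Definition upsilon (Q : R -> R) (s : R) : R := s ^ 2 * Q s ^ 2.

Lemma zeta_derive (Q Q1 : R -> R) (h : profile Q Q1) (s : R) :
  0 < s ->
  is_derive (zeta Q Q1) s
    ((zeta Q Q1 s ^ 2 - zeta Q Q1 s - s ^ 2 + upsilon Q s) / s).
Proof.
  intros Hs; pose proof (profile_d1 _ _ h s Hs) as HD1.
  pose proof (profile_d2 _ _ h s Hs) as HD2.
  pose proof (profile_pos _ _ h s ltac:(lra)).
  unfold zeta, upsilon; derive_with HD1 HD2; field; lra.
Qed.

Lemma upsilon_derive (Q Q1 : R -> R) (h : profile Q Q1) (s : R) :
  0 < s ->
  is_derive (upsilon Q) s (2 * upsilon Q s * (1 - zeta Q Q1 s) / s).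
Proof.
  intros Hs; pose proof (profile_d1 _ _ h s Hs) as HD1.
  pose proof (profile_pos _ _ h s ltac:(lra)).
  unfold zeta, upsilon; derive_with HD1 HD1; field; lra.
Qed.

Lemma upsilon_pos (Q Q1 : R -> R) (h : profile Q Q1) (s : R) : 0 < s -> 0 < upsilon Q s.
Proof.
  intros Hs; apply Rmult_lt_0_compat; apply pow_lt; [exact Hs | apply (profile_pos _ _ h); lra].
Qed.

Lemma slope_eq (Q Q1 : R -> R) (h : profile Q Q1) (s : R) :
  0 < s -> s * Q1 s = - (zeta Q Q1 s * Q s).
Proof.
  intros Hs; pose proof (profile_pos _ _ h s ltac:(lra)); unfold zeta; field; lra.
Qed.

(** The energy inequality multiplied by 2 s^2 / Q^2. *)
Lemma zeta_energy (Q Q1 : R -> R) (h : profile Q Q1) (s : R) :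
  0 < s -> s ^ 2 - upsilon Q s / 2 <= zeta Q Q1 s ^ 2.
Proof.
  intros Hs; pose proof (energy_nonneg Q Q1 h s Hs) as E.
  pose proof (profile_pos _ _ h s ltac:(lra)) as HQ.
  pose proof (slope_eq Q Q1 h s Hs) as HS.
  assert (E2 : 0 <= s ^ 2 * (Q1 s ^ 2 / 2 + Q s ^ 4 / 4 - Q s ^ 2 / 2))
    by (apply Rmult_le_pos; [apply pow2_ge_0 | exact E]).
  replace (s ^ 2 * (Q1 s ^ 2 / 2 + Q s ^ 4 / 4 - Q s ^ 2 / 2)) with
    (Q s ^ 2 / 2 * (zeta Q Q1 s ^ 2 - (s ^ 2 - upsilon Q s / 2))) in E2.
  - assert (0 < Q s ^ 2 / 2) by (assert (0 < Q s ^ 2) by (apply pow_lt; lra); lra).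
    nra.
  - unfold upsilon.
    transitivity ((s * Q1 s) ^ 2 / 2 + s ^ 2 * (Q s ^ 4 / 4 - Q s ^ 2 / 2)); [| field].
    rewrite HS; field.
Qed.

(** The inequality of [flux_nonneg] divided by Q^2, since f' = Q (1 - z). *)
Lemma zeta_flux (Q Q1 : R -> R) (h : profile Q Q1) (s : R) :
  0 < s -> s ^ 2 - upsilon Q s / 2 <= (zeta Q Q1 s - 1) ^ 2.
Proof.
  intros Hs; pose proof (flux_nonneg Q Q1 h s Hs) as E.
  pose proof (profile_pos _ _ h s ltac:(lra)) as HQ.
  rewrite (slope_eq Q Q1 h s Hs) in E.
  replace (_ + _) with
    (Q s ^ 2 * ((zeta Q Q1 s - 1) ^ 2 - (s ^ 2 - upsilon Q s / 2))) in E
    by (unfold upsilon; field).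
  assert (0 < Q s ^ 2) by (apply pow_lt; lra).
  nra.
Qed.

Lemma zeta_le (Q Q1 : R -> R) (h : profile Q Q1) (s : R) :
  0 < s -> zeta Q Q1 s <= 1 + s.
Proof.
  intros Hs; pose proof (decay_rate_bound Q Q1 h s Hs) as E.
  pose proof (profile_pos _ _ h s ltac:(lra)) as HQ.
  rewrite (slope_eq Q Q1 h s Hs) in E.
  nra.
Qed.

(** As s -> 0 the energy tends to Q(0)^4/4 - Q(0)^2/2, because Q' -> 0. *)
Lemma amplitude_ge (Q Q1 : R -> R) (h : profile Q Q1) : 2 <= Q 0 ^ 2.
Proof.
  apply Rnot_lt_le; intros Hlt.
  pose proof (profile_pos _ _ h 0 (Rle_refl 0)) as HQ.
  pose proof (profile_lim0 _ _ h) as L0; pose proof (profile_d1_lim0 _ _ h) as L1.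
  pose proof (filterlim_Rmult _ _ _ _ L0 L0) as LQ2.
  pose proof (filterlim_Rmult _ _ _ _ LQ2 (filterlim_Rplus _ _ _ _ (filterlim_const (1 / 2))
    (filterlim_Rmult _ _ _ _ (filterlim_const (- (1 / 4))) LQ2))) as LA.
  pose proof (filterlim_Rplus _ _ _ _ LA (filterlim_Rmult _ _ _ _ (filterlim_const (- (1 / 2)))
    (filterlim_Rmult _ _ _ _ L1 L1))) as LE.
  destruct (lim_right_pos _ _ LE) as [d [Hd Hpos]].
  { assert (0 < Q 0 * Q 0 * (1 / 2 + - (1 / 4) * (Q 0 * Q 0)))
      by (apply Rmult_lt_0_compat; nra).
    lra. }
  specialize (Hpos (d / 2) ltac:(lra)).
  pose proof (energy_nonneg Q Q1 h (d / 2) ltac:(lra)); nra.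
Qed.

(** The equation in flux form is (s^2 Q')' = s^2 (Q - Q^3). The limit yields z ~ (Q(0)^2 - 1) s^2 /
    3 at the origin. *)
Lemma slope_lim (Q Q1 : R -> R) (h : profile Q Q1) :
  filterlim (fun s => Q1 s / s) (at_right 0) (locally ((Q 0 + - (Q 0 * (Q 0 * Q 0))) / 3)).
Proof.
  pose proof (profile_lim0 _ _ h) as L0.
  apply (lim_of_flux Q1 (fun s => Q s + -1 * (Q s * (Q s * Q s)))).
  - intros s Hs; pose proof (profile_d2 _ _ h s Hs) as HD2.
    derive_with HD2 HD2; field; lra.
  - apply (profile_d1_lim0 _ _ h).
  - replace (- (Q 0 * (Q 0 * Q 0))) with (-1 * (Q 0 * (Q 0 * Q 0))) by ring.
    apply filterlim_Rplus; [exact L0 |].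
    apply filterlim_Rmult; [apply filterlim_const |].
    repeat apply filterlim_Rmult; exact L0.
Qed.

(** Q' < 0 near the origin since Q(0)^2 >= 2. At a zero of Q' the energy forces Q^2 >= 2, hence Q''
    = Q - Q^3 < 0, so Q' cannot climb back to 0. *)
Lemma zeta_pos (Q Q1 : R -> R) (h : profile Q Q1) (s : R) : 0 < s -> 0 < zeta Q Q1 s.
Proof.
  intros Hs.
  pose proof (profile_pos _ _ h 0 (Rle_refl 0)) as HQ0.
  pose proof (amplitude_ge Q Q1 h) as Hamp.
  pose proof (filterlim_Rmult _ _ _ _ (filterlim_const (-1)) (slope_lim Q Q1 h)) as L.
  destruct (lim_right_pos _ _ L) as [d [Hd Hpos]]; [nra |].
  assert (Hbar : forall x, Rmin (d / 2) s <= x <= s -> 0 < - Q1 x).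
  { assert (Hm : 0 < Rmin (d / 2) s <= d / 2 /\ Rmin (d / 2) s <= s)
      by (apply Rmin_case_strong; intros; lra).
    apply (strict_barrier (fun x => - Q1 x)
             (fun x => - (- (2 / x) * Q1 x + Q x - Q x ^ 3))).
    - intros x Hx; apply (is_derive_opp Q1), (profile_d2 _ _ h); lra.
    - specialize (Hpos (Rmin (d / 2) s) ltac:(lra)).
      set (x := Rmin (d / 2) s) in *.
      assert (E : Q1 x = Q1 x / x * x) by (field; lra); nra.
    - intros x Hx Hz.
      pose proof (energy_nonneg Q Q1 h x ltac:(lra)) as E.
      pose proof (profile_pos _ _ h x ltac:(lra)) as HQ.
      replace (Q1 x) with 0 in * by lra.
      assert (2 <= Q x ^ 2).
      { apply Rnot_lt_le; intros Hlt; assert (0 < Q x ^ 2) by (apply pow_lt; lra).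
        nra. }
      nra. }
  specialize (Hbar s ltac:(split; [apply Rmin_r | lra])).
  pose proof (profile_pos _ _ h s ltac:(lra)).
  unfold zeta; apply Rdiv_lt_0_compat; nra.
Qed.

(** * Numerical data *)

Definition with_exp (e : N) (p : list Z) : list dyadic := map (fun m => (m, e)) p.
Definition in_x (p : list dyadic) : poly2 := map (fun c => [c]) p.

(* Coefficients with denominator [2^e] in the variables [x / 2] and [y / 2]. *)
Definition halves (e : N) (p : list (list Z)) : poly2 :=
  comp2 (map (with_exp e) p) [[]; [(1%Z, 1%N)]] [[dzero; (1%Z, 1%N)]].

(* [b_up], [b_lo] are weighted minimax fits, in [x = z] and [y = s^2], of the defect below to
   small functions of constant sign, tightest along the trajectory [Q 0 = 4.3374]. *)
Definition b_up : poly2 := halves 11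
  [[6146; -1344; 995; -1035];
   [-7396; -5854; 2776; 4728];
   [1418; 22234; -12721; -30029];
   [-1941; -62411; 18865; 71611];
   [6784; 86517; -16006; -74964];
   [-5235; -54486; 8150; 36293];
   [1258; 12734; -1798; -6728]]%Z.

Definition b_lo : poly2 := halves 9
  [[1535; -450; -313; 158];
   [-1832; 42; -2461; 2328];
   [87; 1255; 10408; -17183];
   [447; -7078; -21250; 43739];
   [-227; 13594; 21970; -50797];
   [353; -10757; -10307; 27525];
   [-186; 3046; 1642; -5654]]%Z.

(* Approximate solutions in [s] of [s z' = z^2 - z - s^2 + Y] on the two bounding surfaces,
   ending just outside [[2339/1024, 19/8]] at [s = 11/8]. *)
Definition z_lo : list dyadic := with_exp 12
  [146; -2941; 45131; -74128; 59288; -23966; 3921]%Z.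
Definition z_up : list dyadic := with_exp 12
  [132; -2562; 45378; -76045; 61865; -25343; 4208]%Z.

(* [w_in] approximates the solution of the linear equation which vanishes at [51/256 < 1/5];
   [w_mid] is a polynomial in [1 / s]. *)
Definition v_in : list dyadic := with_exp 12
  [5452; -26510; 203915; -797153; 1770513; -2495295; 2334596; -1454065; 581467;
   -135370; 13966]%Z.
Definition w_in : list dyadic := mul1 [((-51)%Z, 8%N); (1%Z, 0%N)] v_in.
Definition w_mid : list dyadic := with_exp 0 [123; -547; 2039; -3000; 2185; -653]%Z.

(* Up to a positive factor, the rate at which the flow leaves [Y = y + x b(x, y)] downwards,
   in the variables [x = z], [y = s^2]. *)
Definition defect (b : poly2) : poly2 :=
  add2 (mul2 (add2 b (mul2 X2 (dx2 b))) (sub2 (add2 b X2) (int2 1)))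
    (mul2 (int2 2) (add2 (sub2 (mul2 Y2 (dy2 b)) b) (add2 (mul2 X2 b) Y2))).

Definition surface (b s z : poly2) : poly2 :=
  add2 (mul2 s s) (mul2 z (comp2 b z (mul2 s s))).

(** Residual of the curve z(s) in s z' = z^2 - z - s^2 + Y, with Y taken on the surface of [b]. *)
Definition curve_defect (b : poly2) (z : list dyadic) : poly2 :=
  let z2 := in_x z in
  sub2 (mul2 X2 (in_x (pderiv dzero dadd z)))
       (sub2 (add2 (mul2 z2 z2) (surface b X2 z2)) (add2 z2 (mul2 X2 X2))).

(** The second variable interpolates between the two curves, so one bivariate check covers every z
    between them. *)
Definition tube : poly2 :=
  add2 (in_x z_lo) (mul2 Y2 (sub2 (in_x z_up) (in_x z_lo))).

(** * The surface swept out by the regular solutions *)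

Lemma ev2_defect (b : poly2) (z q : R) :
  ev2 (defect b) z q =
  (ev2 b z q + z * ev2 (dx2 b) z q) * (ev2 b z q + z - 1) +
  2 * (q * ev2 (dy2 b) z q - ev2 b z q + (z * ev2 b z q + q)).
Proof.
  unfold defect.
  rewrite !ev2_add, !ev2_mul, !ev2_add, !ev2_sub, !ev2_add, !ev2_mul, !ev2_int, !ev2_X, !ev2_Y.
  ring.
Qed.

(** Barrier argument for e times the height of the surface above Y; the sign of e selects an upper
    or a lower bound. At a contact point its derivative is (z/s) times e times the defect. The
    bounds 0 < z <= 1 + s <= 19/8 keep that point in the checked rectangle. *)
Lemma surface_barrier (Q Q1 : R -> R) (h : profile Q Q1) (b : poly2) (e : R) :
  (forall z q, 0 < z <= 19 / 8 -> 0 < q <= 121 / 64 -> 0 < e * ev2 (defect b) z q) ->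
  0 < e * (ev2 b 0 0 - 3) ->
  forall s, 0 < s <= 11 / 8 ->
  0 < e * (s ^ 2 + zeta Q Q1 s * ev2 b (zeta Q Q1 s) (s ^ 2) - upsilon Q s).
Proof.
  intros Hdef H00 s Hs.
  set (phi x := e * (x ^ 2 + zeta Q Q1 x * ev2 b (zeta Q Q1 x) (x ^ 2) - upsilon Q x)).
  assert (Hsmall : exists d, 0 < d /\ forall x, 0 < x < d -> 0 < phi x).
  { pose proof (profile_pos _ _ h 0 (Rle_refl 0)) as HQ0.
    pose proof (amplitude_ge Q Q1 h) as Hamp.
    assert (Lx : filterlim (fun x => x) (at_right 0) (locally 0)).
    { intros P HP; apply filter_le_within, HP. }
    pose proof (filterlim_comp _ _ _ Q Rinv _ _ _ (profile_lim0 _ _ h)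
                  (continuous_Rinv (Q 0) ltac:(lra))) as LV.
    pose proof (filterlim_Rmult _ _ _ _ (filterlim_const (-1))
      (filterlim_Rmult _ _ _ _ (slope_lim Q Q1 h) LV)) as LZ.
    pose proof (filterlim_Rmult _ _ _ _ Lx Lx) as Lx2.
    pose proof (filterlim_Rmult _ _ _ _ Lx2 LZ) as Lz.
    pose proof (ev2_lim b _ _ _ _ Lz Lx2) as Lb.
    pose proof (filterlim_Rmult _ _ _ _ (filterlim_const e)
      (filterlim_Rplus _ _ _ _ (filterlim_const 1)
        (filterlim_Rplus _ _ _ _ (filterlim_Rmult _ _ _ _ LZ Lb)
          (filterlim_Rmult _ _ _ _ (filterlim_const (-1))
            (filterlim_Rmult _ _ _ _ (profile_lim0 _ _ h) (profile_lim0 _ _ h)))))) as L.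
    destruct (lim_right_pos _ _ L) as [d [Hd Hpos]].
    (* The limit of phi / x^2 is e (1 + (Q(0)^2 - 1) b(0,0)/3 - Q(0)^2), which factors through
       b(0,0) - 3. *)
    - rewrite !Rmult_0_l.
      replace (e * _) with ((Q 0 ^ 2 - 1) / 3 * (e * (ev2 b 0 0 - 3))) by (field; lra).
      apply Rmult_lt_0_compat; lra.
    - exists d; split; [exact Hd |]; intros x Hx; specialize (Hpos x Hx); cbv beta in Hpos.
      pose proof (profile_pos _ _ h x ltac:(lra)).
      assert (Ez : x * x * (-1 * (Q1 x / x * / Q x)) = zeta Q Q1 x)
        by (unfold zeta; field; lra).
      rewrite Ez in Hpos.
      replace (phi x) with
        (x ^ 2 * (e * (1 + (-1 * (Q1 x / x * / Q x) * ev2 b (zeta Q Q1 x) (x * x)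
                            + -1 * (Q x * Q x))))).
      + apply Rmult_lt_0_compat; [apply pow_lt; lra | exact Hpos].
      + unfold phi, upsilon; rewrite <- Ez at 2; replace (x ^ 2) with (x * x) by ring; ring. }
  destruct Hsmall as [d [Hd Hpos]].
  assert (Hm : 0 < Rmin (d / 2) s <= d / 2 /\ Rmin (d / 2) s <= s)
    by (apply Rmin_case_strong; intros; lra).
  apply (strict_barrier phi
    (fun x => e * (2 * x
      + ((zeta Q Q1 x ^ 2 - zeta Q Q1 x - x ^ 2 + upsilon Q x) / x
           * ev2 b (zeta Q Q1 x) (x ^ 2)
         + zeta Q Q1 x
           * ((zeta Q Q1 x ^ 2 - zeta Q Q1 x - x ^ 2 + upsilon Q x) / x
                * ev2 (dx2 b) (zeta Q Q1 x) (x ^ 2)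
              + 2 * x * ev2 (dy2 b) (zeta Q Q1 x) (x ^ 2)))
      - 2 * upsilon Q x * (1 - zeta Q Q1 x) / x)) (Rmin (d / 2) s) s); [| | | lra].
  - intros x Hx.
    pose proof (zeta_derive Q Q1 h x ltac:(lra)) as Dz.
    pose proof (upsilon_derive Q Q1 h x ltac:(lra)) as Dy.
    assert (Dq : is_derive (fun x => x ^ 2) x (2 * x)) by (auto_derive; [exact I | ring]).
    apply (is_derive_scal (fun x => x ^ 2 + zeta Q Q1 x * ev2 b (zeta Q Q1 x) (x ^ 2) - upsilon Q x)).
    apply (is_derive_minus (fun x => x ^ 2 + zeta Q Q1 x * ev2 b (zeta Q Q1 x) (x ^ 2))
             (upsilon Q)); [| exact Dy].
    apply (is_derive_horner (fun x => x ^ 2) (zeta Q Q1)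
             (fun x => ev2 b (zeta Q Q1 x) (x ^ 2))); [exact Dq | exact Dz |].
    apply (ev2_derive b (zeta Q Q1) (fun x => x ^ 2)); [exact Dz | exact Dq].
  - apply Hpos; lra.
  - intros x Hx Hzero.
    pose proof (zeta_pos Q Q1 h x ltac:(lra)) as Z0.
    pose proof (zeta_le Q Q1 h x ltac:(lra)) as Z1.
    assert (He : e <> 0) by (intros ->; lra).
    assert (EY : upsilon Q x = x ^ 2 + zeta Q Q1 x * ev2 b (zeta Q Q1 x) (x ^ 2)).
    { unfold phi in Hzero; apply Rmult_integral in Hzero; destruct Hzero; [contradiction | lra]. }
    assert (0 < x ^ 2) by (apply pow_lt; lra).
    specialize (Hdef (zeta Q Q1 x) (x ^ 2) ltac:(lra) ltac:(nra)).
    rewrite ev2_defect in Hdef.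
    rewrite EY.
    match goal with |- 0 < ?rhs =>
      replace rhs with (zeta Q Q1 x / x * (e * ((ev2 b (zeta Q Q1 x) (x ^ 2) +
        zeta Q Q1 x * ev2 (dx2 b) (zeta Q Q1 x) (x ^ 2)) *
       (ev2 b (zeta Q Q1 x) (x ^ 2) + zeta Q Q1 x - 1) +
       2 * (x ^ 2 * ev2 (dy2 b) (zeta Q Q1 x) (x ^ 2) - ev2 b (zeta Q Q1 x) (x ^ 2) +
            (zeta Q Q1 x * ev2 b (zeta Q Q1 x) (x ^ 2) + x ^ 2))))) by (field; lra) end.
    apply Rmult_lt_0_compat; [apply Rdiv_lt_0_compat; lra | exact Hdef].
Qed.

Lemma defect_up_check :
  pos_on 20 40 (defect b_up) (0%Z, 0%N) (19%Z, 3%N) (0%Z, 0%N) (121%Z, 6%N) = true.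
Proof. vm_compute; reflexivity. Qed.

Lemma defect_lo_check :
  pos_on 20 40 (sub2 [] (defect b_lo)) (0%Z, 0%N) (19%Z, 3%N) (0%Z, 0%N) (121%Z, 6%N) = true.
Proof. vm_compute; reflexivity. Qed.

(** On regular solutions (Y - s^2)/z tends to 3 at the origin; [b_up] starts just above 3 and [b_lo]
    just below. *)
Lemma b_up_origin : ev2 b_up 0 0 = 6146 / 2048.
Proof. unfold b_up, halves; rewrite ev2_comp2; unfold ev2, ev1, dval; simpl; lra. Qed.

Lemma b_lo_origin : ev2 b_lo 0 0 = 1535 / 512.
Proof. unfold b_lo, halves; rewrite ev2_comp2; unfold ev2, ev1, dval; simpl; lra. Qed.

Definition level (b : poly2) (s z : R) : R := s ^ 2 + z * ev2 b z (s ^ 2).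

Ltac dyadic_bounds := unfold dval; simpl; lra.

Lemma upsilon_lt_up (Q Q1 : R -> R) (h : profile Q Q1) (s : R) :
  0 < s <= 11 / 8 -> upsilon Q s < level b_up s (zeta Q Q1 s).
Proof.
  intros Hs; unfold level.
  enough (0 < 1 * (s ^ 2 + zeta Q Q1 s * ev2 b_up (zeta Q Q1 s) (s ^ 2) - upsilon Q s)) by lra.
  apply (surface_barrier Q Q1 h); [| rewrite b_up_origin; lra | exact Hs].
  intros z q Hz Hq; rewrite Rmult_1_l.
  apply (pos_on_sound _ _ _ _ _ _ _ _ _ defect_up_check); dyadic_bounds.
Qed.

Lemma upsilon_gt_lo (Q Q1 : R -> R) (h : profile Q Q1) (s : R) :
  0 < s <= 11 / 8 -> level b_lo s (zeta Q Q1 s) < upsilon Q s.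
Proof.
  intros Hs; unfold level.
  enough (0 < -1 * (s ^ 2 + zeta Q Q1 s * ev2 b_lo (zeta Q Q1 s) (s ^ 2) - upsilon Q s)) by lra.
  apply (surface_barrier Q Q1 h); [| rewrite b_lo_origin; lra | exact Hs].
  intros z q Hz Hq.
  pose proof (pos_on_sound _ _ _ _ _ _ _ z q defect_lo_check) as P.
  rewrite ev2_sub in P; change (ev2 [] z q) with 0 in P.
  enough (0 < 0 - ev2 (defect b_lo) z q) by lra.
  apply P; dyadic_bounds.
Qed.

Lemma ev2_surface (b s z : poly2) (x y : R) :
  ev2 (surface b s z) x y = level b (ev2 s x y) (ev2 z x y).
Proof.
  unfold surface, level; rewrite ev2_add, !ev2_mul, ev2_comp2, ev2_mul.
  replace (ev2 s x y * ev2 s x y) with (ev2 s x y ^ 2) by ring; reflexivity.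
Qed.

(** * Constraints at the end point s = 11/8 *)

Definition end_point : poly2 := const2 (11%Z, 3%N).

Lemma end_energy_check :
  pos_on 20 40 (sub2 (mul2 (int2 2) (sub2 (mul2 end_point end_point) (mul2 X2 X2)))
                     (surface b_up end_point X2))
    (0%Z, 0%N) (1%Z, 1%N) (0%Z, 0%N) (1%Z, 0%N) = true.
Proof. vm_compute; reflexivity. Qed.

Lemma end_flux_check :
  pos_on 20 40 (sub2 (mul2 (int2 2) (sub2 (mul2 end_point end_point)
                        (mul2 (sub2 X2 (int2 1)) (sub2 X2 (int2 1)))))
                     (surface b_up end_point X2))
    (31%Z, 6%N) (2339%Z, 10%N) (0%Z, 0%N) (1%Z, 0%N) = true.
Proof. vm_compute; reflexivity. Qed.

Lemma end_value_check :
  pos_on 20 40 (sub2 (int2 29) (mul2 (int2 32) (mul2 (mul2 end_point end_point)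
                                                     (surface b_up end_point X2))))
    (2337%Z, 10%N) (19%Z, 3%N) (0%Z, 0%N) (1%Z, 0%N) = true.
Proof. vm_compute; reflexivity. Qed.

(** Smaller values of z are impossible: the energy inequality for z <= 1/2, and the flux inequality
    above 1/2, would require Y to exceed its bound on the upper surface. *)
Lemma zeta_end (Q Q1 : R -> R) (h : profile Q Q1) : 2339 / 1024 < zeta Q Q1 (11 / 8).
Proof.
  set (z := zeta Q Q1 (11 / 8)).
  pose proof (zeta_pos Q Q1 h (11 / 8) ltac:(lra)) as Z0.
  pose proof (upsilon_lt_up Q Q1 h (11 / 8) ltac:(lra)) as U.
  pose proof (zeta_energy Q Q1 h (11 / 8) ltac:(lra)) as E.
  pose proof (zeta_flux Q Q1 h (11 / 8) ltac:(lra)) as F.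
  fold z in Z0, U, E, F.
  assert (Hend : forall x y, ev2 end_point x y = 11 / 8)
    by (intros; unfold end_point; rewrite ev2_const; unfold dval; simpl; lra).
  apply Rnot_le_lt; intros Hz.
  destruct (Rle_or_lt z (1 / 2)) as [Hz2 | Hz2].
  (* The polynomial depends on the first variable only; [1 / 2] is a dummy value in (0, 1] for the
     second. *)
  - pose proof (pos_on_sound _ _ _ _ _ _ _ z (1 / 2) end_energy_check) as P.
    rewrite ev2_sub, ev2_mul, ev2_sub, !ev2_mul, ev2_surface, ev2_int, !ev2_X, !Hend in P.
    specialize (P ltac:(dyadic_bounds) ltac:(dyadic_bounds)); lra.
  - pose proof (pos_on_sound _ _ _ _ _ _ _ z (1 / 2) end_flux_check) as P.
    rewrite ev2_sub, ev2_mul, ev2_sub, !ev2_mul, ev2_sub, ev2_surface, !ev2_int, !ev2_X, !Hend in P.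
    specialize (P ltac:(dyadic_bounds) ltac:(dyadic_bounds)); lra.
Qed.

(** * Explicit bounds on z, propagated backwards from s = 11/8 *)

Lemma ev2_in_x (p : list dyadic) (x y : R) : ev2 (in_x p) x y = ev1 p x.
Proof.
  induction p as [| c p IH]; [reflexivity |].
  unfold ev2, ev1 in *; simpl; rewrite IH; ring.
Qed.

Lemma ev1_poly_derive (p : list dyadic) (s : R) :
  is_derive (ev1 p) s (ev1 (pderiv dzero dadd p) s).
Proof.
  rewrite <- (Rmult_1_l (ev1 (pderiv dzero dadd p) s)).
  apply (ev1_derive p (fun s => s)); auto_derive; [exact I | reflexivity].
Qed.

Lemma ev2_curve_defect (b : poly2) (z : list dyadic) (s y : R) :
  ev2 (curve_defect b z) s y =
  s * ev1 (pderiv dzero dadd z) s - (ev1 z s ^ 2 - ev1 z s - s ^ 2 + level b s (ev1 z s)).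
Proof.
  unfold curve_defect; cbv zeta.
  rewrite !ev2_sub, !ev2_add, !ev2_mul, ev2_surface, !ev2_in_x, !ev2_X; ring.
Qed.

Lemma curve_lo_check :
  pos_on 20 40 (curve_defect b_up z_lo) (25%Z, 7%N) (11%Z, 3%N) (0%Z, 0%N) (1%Z, 0%N) = true.
Proof. vm_compute; reflexivity. Qed.

Lemma curve_up_check :
  pos_on 20 40 (sub2 [] (curve_defect b_lo z_up)) (25%Z, 7%N) (11%Z, 3%N) (0%Z, 0%N) (1%Z, 0%N)
  = true.
Proof. vm_compute; reflexivity. Qed.

Lemma z_lo_end : ev1 z_lo (11 / 8) < 2339 / 1024.
Proof. unfold ev1, z_lo, dval; simpl; lra. Qed.

Lemma z_up_end : 19 / 8 < ev1 z_up (11 / 8).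
Proof. unfold ev1, z_up, dval; simpl; lra. Qed.

(** Wherever the two curves meet, [z_lo] has the larger slope, because Y lies below the upper
    surface. So z < [z_lo] at s would persist up to 11/8, where [zeta_end] contradicts it. *)
Lemma zeta_ge_lo (Q Q1 : R -> R) (h : profile Q Q1) (s : R) :
  25 / 128 < s <= 11 / 8 -> ev1 z_lo s <= zeta Q Q1 s.
Proof.
  intros Hs; apply Rnot_lt_le; intros Hlt.
  enough (0 < ev1 z_lo (11 / 8) - zeta Q Q1 (11 / 8))
    by (pose proof z_lo_end; pose proof (zeta_end Q Q1 h); lra).
  apply (strict_barrier (fun x => ev1 z_lo x - zeta Q Q1 x)
    (fun x => ev1 (pderiv dzero dadd z_lo) x -
       (zeta Q Q1 x ^ 2 - zeta Q Q1 x - x ^ 2 + upsilon Q x) / x) s (11 / 8)); [| lra | | lra].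
  - intros x Hx; apply (is_derive_minus (ev1 z_lo) (zeta Q Q1));
      [apply ev1_poly_derive | apply (zeta_derive Q Q1 h); lra].
  - intros x Hx Hzero.
    assert (E : zeta Q Q1 x = ev1 z_lo x) by lra.
    pose proof (upsilon_lt_up Q Q1 h x ltac:(lra)) as U.
    pose proof (pos_on_sound _ _ _ _ _ _ _ x (1 / 2) curve_lo_check
      ltac:(dyadic_bounds) ltac:(dyadic_bounds)) as P.
    rewrite ev2_curve_defect in P; rewrite E in U |- *.
    apply (Rmult_lt_reg_r x); [lra |].
    rewrite Rmult_minus_distr_r; field_simplify; [nra | lra].
Qed.

(** Mirror image of [zeta_ge_lo], with the lower surface and the end bound z <= 1 + 11/8 = 19/8. *)
Lemma zeta_le_up (Q Q1 : R -> R) (h : profile Q Q1) (s : R) :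
  25 / 128 < s <= 11 / 8 -> zeta Q Q1 s <= ev1 z_up s.
Proof.
  intros Hs; apply Rnot_lt_le; intros Hlt.
  enough (0 < zeta Q Q1 (11 / 8) - ev1 z_up (11 / 8))
    by (pose proof z_up_end; pose proof (zeta_le Q Q1 h (11 / 8)); lra).
  apply (strict_barrier (fun x => zeta Q Q1 x - ev1 z_up x)
    (fun x => (zeta Q Q1 x ^ 2 - zeta Q Q1 x - x ^ 2 + upsilon Q x) / x -
       ev1 (pderiv dzero dadd z_up) x) s (11 / 8)); [| lra | | lra].
  - intros x Hx; apply (is_derive_minus (zeta Q Q1) (ev1 z_up));
      [apply (zeta_derive Q Q1 h); lra | apply ev1_poly_derive].
  - intros x Hx Hzero.
    assert (E : zeta Q Q1 x = ev1 z_up x) by lra.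
    pose proof (upsilon_gt_lo Q Q1 h x ltac:(lra)) as U.
    pose proof (pos_on_sound _ _ _ _ _ _ _ x (1 / 2) curve_up_check
      ltac:(dyadic_bounds) ltac:(dyadic_bounds)) as P.
    rewrite ev2_sub in P; change (ev2 [] x (1 / 2)) with 0 in P.
    rewrite ev2_curve_defect in P; rewrite E in U |- *.
    apply (Rmult_lt_reg_r x); [lra |].
    rewrite Rmult_minus_distr_r; field_simplify; [nra | lra].
Qed.

(** s^2 Y decreases where z > 2. At equality Y <= 1/2, so the flux inequality gives (z - 1)^2 > 1,
    and z > 0 leaves only z > 2. *)
Lemma upsilon_tail (Q Q1 : R -> R) (h : profile Q Q1) (s : R) :
  11 / 8 <= s -> s ^ 2 * upsilon Q s <= 29 / 32.
Proof.
  intros Hs.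
  enough (0 < 29 / 32 / s ^ 2 - upsilon Q s).
  { assert (0 < s ^ 2) by (apply pow_lt; lra).
    assert (E : s ^ 2 * (29 / 32 / s ^ 2) = 29 / 32) by (field; lra).
    nra. }
  apply (strict_barrier (fun x => 29 / 32 / x ^ 2 - upsilon Q x)
    (fun x => - (2 * (29 / 32) / x ^ 3) - 2 * upsilon Q x * (1 - zeta Q Q1 x) / x)
    (11 / 8) s); [| | | lra].
  - intros x Hx; apply (is_derive_minus (fun x => 29 / 32 / x ^ 2) (upsilon Q));
      [| apply (upsilon_derive Q Q1 h); lra].
    auto_derive; [nra | field; lra].
  - pose proof (upsilon_lt_up Q Q1 h (11 / 8) ltac:(lra)) as U.
    pose proof (zeta_end Q Q1 h); pose proof (zeta_le Q Q1 h (11 / 8) ltac:(lra)).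
    pose proof (pos_on_sound _ _ _ _ _ _ _ (zeta Q Q1 (11 / 8)) (1 / 2) end_value_check
      ltac:(dyadic_bounds) ltac:(dyadic_bounds)) as P.
    assert (Hend : forall x y, ev2 end_point x y = 11 / 8)
      by (intros; unfold end_point; rewrite ev2_const; unfold dval; simpl; lra).
    rewrite ev2_sub, !ev2_mul, ev2_surface, !ev2_int, ev2_X, !Hend in P.
    lra.
  - intros x Hx Hzero.
    assert (E : upsilon Q x = 29 / 32 / x ^ 2) by lra.
    pose proof (zeta_flux Q Q1 h x ltac:(lra)) as F.
    pose proof (zeta_pos Q Q1 h x ltac:(lra)) as Z0.
    pose proof (upsilon_pos Q Q1 h x ltac:(lra)) as Y0.
    assert (Hx2 : 121 / 64 <= x ^ 2) by nra.
    assert (HY : upsilon Q x <= 1 / 2).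
    { rewrite E; apply (Rmult_le_reg_r (x ^ 2)); [lra |]; field_simplify; lra. }
    assert (2 < zeta Q Q1 x) by nra.
    replace (2 * (29 / 32) / x ^ 3) with (2 * upsilon Q x / x) by (rewrite E; field; lra).
    replace (_ - _) with (2 * upsilon Q x * (zeta Q Q1 x - 2) / x) by (field; lra).
    apply Rdiv_lt_0_compat; [apply Rmult_lt_0_compat |]; lra.
Qed.

(** * Positive supersolutions of the linearized equation *)

Definition supersolution (Q w w1 w2 : R -> R) (s : R) : Prop :=
  is_derive w s (w1 s) /\ is_derive w1 s (w2 s) /\ 0 < w s /\
  w2 s <= (2 / s ^ 2 - 3 * Q s ^ 2) * w s.

Lemma supersolution_of_log (Q w w1 w2 : R -> R) (s : R) :
  0 < s -> is_derive w s (w1 s) -> is_derive w1 s (w2 s) -> 0 < w s ->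
  s ^ 2 * w2 s <= (2 - 3 * upsilon Q s) * w s -> supersolution Q w w1 w2 s.
Proof.
  intros Hs D1 D2 Hw H; split; [exact D1 | split; [exact D2 | split; [exact Hw |]]].
  assert (0 < s ^ 2) by (apply pow_lt; lra).
  apply (Rmult_le_reg_l (s ^ 2)); [assumption |].
  replace (s ^ 2 * ((2 / s ^ 2 - 3 * Q s ^ 2) * w s)) with ((2 - 3 * upsilon Q s) * w s)
    by (unfold upsilon; field; lra).
  exact H.
Qed.

Definition w_in1 : R -> R := ev1 (pderiv dzero dadd w_in).
Definition w_in2 : R -> R := ev1 (pderiv dzero dadd (pderiv dzero dadd w_in)).

(** The second side starts at -1/64 so that the half-open rectangle contains the edge [z_lo] of the
    tube. *)
Lemma w_in_check :
  pos_on 20 40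
    (sub2 (mul2 (sub2 (int2 2) (mul2 (int2 3) (surface b_up X2 tube))) (in_x w_in))
       (mul2 (mul2 X2 X2) (in_x (pderiv dzero dadd (pderiv dzero dadd w_in)))))
    (51%Z, 8%N) (11%Z, 3%N) ((-1)%Z, 6%N) (1%Z, 0%N) = true.
Proof. vm_compute; reflexivity. Qed.

Lemma v_in_check :
  pos_on 20 40 (in_x v_in) (51%Z, 8%N) (11%Z, 3%N) (0%Z, 0%N) (1%Z, 0%N) = true.
Proof. vm_compute; reflexivity. Qed.

(** Y enters with a negative sign against w > 0, so it may be replaced by its upper bound on the
    surface, at a point of the tube. *)
Lemma supersolution_in (Q Q1 : R -> R) (h : profile Q Q1) (s : R) :
  51 / 256 < s <= 11 / 8 -> supersolution Q (ev1 w_in) w_in1 w_in2 s.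
Proof.
  intros Hs.
  assert (Hw : 0 < ev1 w_in s).
  { pose proof (pos_on_sound _ _ _ _ _ _ _ s (1 / 2) v_in_check
      ltac:(dyadic_bounds) ltac:(dyadic_bounds)) as P.
    rewrite ev2_in_x in P; unfold w_in; rewrite ev1_mul.
    apply Rmult_lt_0_compat; [unfold ev1, dval; simpl; lra | exact P]. }
  apply supersolution_of_log; [lra | apply ev1_poly_derive | apply ev1_poly_derive | exact Hw |].
  pose proof (upsilon_lt_up Q Q1 h s ltac:(lra)) as U.
  pose proof (zeta_ge_lo Q Q1 h s ltac:(lra)) as L.
  pose proof (zeta_le_up Q Q1 h s ltac:(lra)) as R.
  assert (Hlam : exists lam, 0 <= lam <= 1 /\
            zeta Q Q1 s = ev1 z_lo s + lam * (ev1 z_up s - ev1 z_lo s)).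
  { destruct (Rle_lt_or_eq_dec (ev1 z_lo s) (ev1 z_up s) ltac:(lra)) as [Hlt | Heq].
    - exists ((zeta Q Q1 s - ev1 z_lo s) / (ev1 z_up s - ev1 z_lo s)); split; [split |].
      + apply Rmult_le_pos; [lra | left; apply Rinv_0_lt_compat; lra].
      + apply (Rmult_le_reg_r (ev1 z_up s - ev1 z_lo s)); [lra |]; field_simplify; lra.
      + field; lra.
    - exists 0; lra. }
  destruct Hlam as [lam [Hlam Ez]].
  pose proof (pos_on_sound _ _ _ _ _ _ _ s lam w_in_check
    ltac:(dyadic_bounds) ltac:(dyadic_bounds)) as P.
  unfold tube in P.
  rewrite ev2_sub, !ev2_mul, ev2_sub, ev2_mul, ev2_surface, !ev2_add, !ev2_mul, ev2_sub,
    !ev2_int, !ev2_in_x, !ev2_X, ev2_Y, <- Ez in P.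
  fold (w_in2 s) in P.
  nra.
Qed.

Definition w_mid0 (s : R) : R := ev1 w_mid (/ s).
Definition w_mid1 (s : R) : R := - (/ s) ^ 2 * ev1 (pderiv dzero dadd w_mid) (/ s).
Definition w_mid2 (s : R) : R :=
  2 * (/ s) ^ 3 * ev1 (pderiv dzero dadd w_mid) (/ s)
  + (/ s) ^ 4 * ev1 (pderiv dzero dadd (pderiv dzero dadd w_mid)) (/ s).

(** Written in r = 1/s: the tail bound gives 3 Y <= 87 r^2 / 32, and s^2 d^2/ds^2 becomes 2 r d/dr +
    r^2 d^2/dr^2. *)
Lemma w_mid_check :
  pos_on 20 40
    (sub2 (mul2 (sub2 (int2 2) (mul2 (const2 (87%Z, 5%N)) (mul2 X2 X2))) (in_x w_mid))
       (mul2 X2 (add2 (mul2 (int2 2) (in_x (pderiv dzero dadd w_mid)))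
                      (mul2 X2 (in_x (pderiv dzero dadd (pderiv dzero dadd w_mid)))))))
    (3%Z, 3%N) (3%Z, 2%N) (0%Z, 0%N) (1%Z, 0%N) = true.
Proof. vm_compute; reflexivity. Qed.

Lemma w_mid_pos_check :
  pos_on 20 40 (in_x w_mid) (3%Z, 3%N) (3%Z, 2%N) (0%Z, 0%N) (1%Z, 0%N) = true.
Proof. vm_compute; reflexivity. Qed.

Lemma inv_bounds (a b s : R) : 0 < a -> a <= s <= b -> / b <= / s <= / a.
Proof. intros Ha Hs; split; apply Rinv_le_contravar; lra. Qed.

Lemma supersolution_mid (Q Q1 : R -> R) (h : profile Q Q1) (s : R) :
  11 / 8 <= s <= 5 / 2 -> supersolution Q w_mid0 w_mid1 w_mid2 s.
Proof.
  intros Hs; pose proof (inv_bounds (11 / 8) (5 / 2) s ltac:(lra) Hs) as Hr.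
  assert (Dinv : is_derive (fun s => / s) s (- (/ s) ^ 2))
    by (auto_derive; [lra | field; lra]).
  assert (Hw : 0 < ev1 w_mid (/ s)).
  { rewrite <- (ev2_in_x w_mid (/ s) (1 / 2)).
    apply (pos_on_sound _ _ _ _ _ _ _ _ _ w_mid_pos_check); dyadic_bounds. }
  apply supersolution_of_log; [lra | | | exact Hw |].
  - apply (ev1_derive w_mid (fun s => / s)), Dinv.
  - pose proof (ev1_derive (pderiv dzero dadd w_mid) (fun s => / s) s _ Dinv) as D.
    assert (D2 : is_derive (fun s => - (/ s) ^ 2) s (2 * (/ s) ^ 3))
      by (auto_derive; [lra | field; lra]).
    pose proof (is_derive_mult (fun s => - (/ s) ^ 2)
      (fun s => ev1 (pderiv dzero dadd w_mid) (/ s)) s _ _ D2 D Rmult_comm) as P.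
    replace (w_mid2 s) with
      (plus (mult (2 * (/ s) ^ 3) (ev1 (pderiv dzero dadd w_mid) (/ s)))
         (mult (- (/ s) ^ 2)
           (- (/ s) ^ 2 * ev1 (pderiv dzero dadd (pderiv dzero dadd w_mid)) (/ s)))).
    + exact P.
    + unfold w_mid2, plus, mult; simpl; ring.
  - pose proof (upsilon_tail Q Q1 h s ltac:(lra)) as T.
    pose proof (pos_on_sound _ _ _ _ _ _ _ (/ s) (1 / 2) w_mid_check
      ltac:(dyadic_bounds) ltac:(dyadic_bounds)) as P.
    rewrite ev2_sub, !ev2_mul, ev2_sub, ev2_add, !ev2_mul, ev2_const, !ev2_int, !ev2_in_x,
      !ev2_X in P.
    replace (dval (87%Z, 5%N)) with (87 / 32) in P by (unfold dval; simpl; lra).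
    fold (w_mid0 s) in P, Hw.
    replace (s ^ 2 * w_mid2 s) with
      (/ s * (2 * ev1 (pderiv dzero dadd w_mid) (/ s)
        + / s * ev1 (pderiv dzero dadd (pderiv dzero dadd w_mid)) (/ s)))
      by (unfold w_mid2; field; lra).
    assert (HY : upsilon Q s <= 29 / 32 * (/ s * / s)).
    { replace (29 / 32 * (/ s * / s)) with (29 / 32 / s ^ 2) by (field; lra).
      apply (Rmult_le_reg_l (s ^ 2)); [apply pow_lt; lra |]; field_simplify; lra. }
    assert (3 * upsilon Q s * w_mid0 s <= 87 / 32 * (/ s * / s) * w_mid0 s)
      by (apply Rmult_le_compat_r; lra).
    lra.
Qed.

(** 1/s solves w'' = 2 w / s^2 exactly. The constant 1/4 provides the slack that absorbs 3 Q^2 w and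
    keeps w away from 0 at infinity. *)
Definition w_out (s : R) : R := 1 / 4 + / s.
Definition w_out1 (s : R) : R := - / s ^ 2.
Definition w_out2 (s : R) : R := 2 / s ^ 3.

Lemma supersolution_out (Q Q1 : R -> R) (h : profile Q Q1) (s : R) :
  5 / 2 <= s -> supersolution Q w_out w_out1 w_out2 s.
Proof.
  intros Hs.
  assert (Hi : 0 < / s <= 2 / 5).
  { split; [apply Rinv_0_lt_compat; lra |].
    replace (2 / 5) with (/ (5 / 2)) by field; apply Rinv_le_contravar; lra. }
  apply supersolution_of_log; [lra | | | unfold w_out; lra |].
  - unfold w_out, w_out1; auto_derive; [lra | field; lra].
  - unfold w_out1, w_out2; auto_derive; [nra | field; lra].
  - pose proof (upsilon_tail Q Q1 h s ltac:(lra)) as T.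
    assert (HY : upsilon Q s <= 29 / 32 * (/ s * / s)).
    { replace (29 / 32 * (/ s * / s)) with (29 / 32 / s ^ 2) by (field; lra).
      apply (Rmult_le_reg_l (s ^ 2)); [apply pow_lt; lra |]; field_simplify; lra. }
    replace (s ^ 2 * w_out2 s) with (2 * / s) by (unfold w_out2; field; lra).
    unfold w_out; set (r := / s) in *.
    assert (upsilon Q s <= 29 / 32 * (4 / 25)) by nra.
    nra.
Qed.

(** * Downward jumps of the logarithmic slope at the junctions 11/8 and 5/2 *)

Lemma kink_in_check :
  pos_on 20 40 (add2 (in_x (pderiv dzero dadd w_in)) (mul2 (const2 (905%Z, 11%N)) (in_x w_in)))
    (1407%Z, 10%N) (11%Z, 3%N) (0%Z, 0%N) (1%Z, 0%N) = true.
Proof. vm_compute; reflexivity. Qed.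

Lemma kink_mid_check :
  pos_on 20 40 (sub2 (mul2 (mul2 X2 X2) (in_x (pderiv dzero dadd w_mid)))
                     (mul2 (const2 (905%Z, 11%N)) (in_x w_mid)))
    (11915%Z, 14%N) (11916%Z, 14%N) (0%Z, 0%N) (1%Z, 0%N) = true.
Proof. vm_compute; reflexivity. Qed.

Lemma kink_out_check :
  pos_on 20 40 (sub2 (mul2 (const2 (63%Z, 8%N)) (in_x w_mid))
                     (mul2 (mul2 X2 X2) (in_x (pderiv dzero dadd w_mid))))
    (25%Z, 6%N) (13%Z, 5%N) (0%Z, 0%N) (1%Z, 0%N) = true.
Proof. vm_compute; reflexivity. Qed.

(** The number -905/2048 separates the logarithmic slopes of [w_in] and [w_mid] at 11/8; it is
    checked on thin intervals around 11/8 and 8/11. *)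
Lemma kink_in_mid :
  w_mid1 (11 / 8) * ev1 w_in (11 / 8) <= w_in1 (11 / 8) * w_mid0 (11 / 8).
Proof.
  pose proof (pos_on_sound _ _ _ _ _ _ _ (11 / 8) (1 / 2) kink_in_check
    ltac:(dyadic_bounds) ltac:(dyadic_bounds)) as P.
  pose proof (pos_on_sound _ _ _ _ _ _ _ (/ (11 / 8)) (1 / 2) kink_mid_check
    ltac:(dyadic_bounds) ltac:(dyadic_bounds)) as P'.
  pose proof (pos_on_sound _ _ _ _ _ _ _ (/ (11 / 8)) (1 / 2) w_mid_pos_check
    ltac:(dyadic_bounds) ltac:(dyadic_bounds)) as W'.
  pose proof (pos_on_sound _ _ _ _ _ _ _ (11 / 8) (1 / 2) v_in_check
    ltac:(dyadic_bounds) ltac:(dyadic_bounds)) as W.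
  rewrite ev2_add, ev2_mul, ev2_const, !ev2_in_x in P.
  rewrite ev2_sub, !ev2_mul, ev2_const, !ev2_in_x, !ev2_X in P'.
  rewrite ev2_in_x in W, W'.
  assert (Hw : 0 < ev1 w_in (11 / 8)).
  { unfold w_in; rewrite ev1_mul.
    apply Rmult_lt_0_compat; [unfold ev1, dval; simpl; lra | exact W]. }
  fold (w_in1 (11 / 8)) in P.
  unfold w_mid1, w_mid0.
  set (q := dval (905%Z, 11%N)) in *.
  set (m := ev1 w_mid (/ (11 / 8))) in *.
  set (m1 := ev1 (pderiv dzero dadd w_mid) (/ (11 / 8))) in *.
  replace (- (/ (11 / 8)) ^ 2 * m1) with (- (/ (11 / 8) * / (11 / 8) * m1)) by ring.
  nra.
Qed.

(** At 5/2 the logarithmic slope of [w_out] is -16/65, just below the separating value -63/256. *)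
Lemma kink_mid_out : w_out1 (5 / 2) * w_mid0 (5 / 2) <= w_mid1 (5 / 2) * w_out (5 / 2).
Proof.
  pose proof (pos_on_sound _ _ _ _ _ _ _ (/ (5 / 2)) (1 / 2) kink_out_check
    ltac:(dyadic_bounds) ltac:(dyadic_bounds)) as P.
  pose proof (pos_on_sound _ _ _ _ _ _ _ (/ (5 / 2)) (1 / 2) w_mid_pos_check
    ltac:(dyadic_bounds) ltac:(dyadic_bounds)) as W.
  rewrite ev2_sub, !ev2_mul, ev2_const, !ev2_in_x, !ev2_X in P.
  rewrite ev2_in_x in W.
  replace (dval (63%Z, 8%N)) with (63 / 256) in P by (unfold dval; simpl; lra).
  unfold w_out1, w_out, w_mid1, w_mid0.
  replace (/ (5 / 2)) with (2 / 5) in * by field.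
  replace (/ (5 / 2) ^ 2) with (4 / 25) by field.
  lra.
Qed.

(** * Comparison with the supersolutions *)

(* The Wronskian [G' w - G w'] grows as long as [G] is positive, and it controls [(G / w)']. *)
Lemma sturm_comparison (G G1 V w w1 w2 : R -> R) (a b : R) :
  (forall t, a <= t <= b -> is_derive G t (G1 t)) ->
  (forall t, a <= t <= b -> is_derive G1 t (V t * G t)) ->
  (forall t, a <= t <= b -> is_derive w t (w1 t)) ->
  (forall t, a <= t <= b -> is_derive w1 t (w2 t)) ->
  (forall t, a <= t <= b -> 0 < w t) ->
  (forall t, a <= t <= b -> w2 t <= V t * w t) ->
  0 < G a -> 0 < G1 a * w a - G a * w1 a ->
  forall t, a <= t <= b ->
  0 < G t /\ G1 a * w a - G a * w1 a <= G1 t * w t - G t * w1 t.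
Proof.
  intros DG DG1 Dw Dw1 Hw Hsup HGa HKa.
  set (K t := G1 t * w t - G t * w1 t); change (0 < K a) in HKa.
  assert (HK : forall c, a <= c <= b -> (forall t, a <= t <= c -> 0 <= G t) -> K a <= K c).
  { intros c Hc HG.
    enough (K a + 0 * (c - a) <= K c) by lra.
    apply (growth_lower_bound K (fun t => (V t * w t - w2 t) * G t)); [lra | |].
    - intros t Ht.
      replace ((V t * w t - w2 t) * G t)
        with (V t * G t * w t + G1 t * w1 t - (G1 t * w1 t + G t * w2 t)) by ring.
      apply (is_derive_minus (fun t => G1 t * w t) (fun t => G t * w1 t)).
      + apply (is_derive_mult G1 w); [apply DG1 | apply Dw | exact Rmult_comm]; lra.
      + apply (is_derive_mult G w1); [apply DG | apply Dw1 | exact Rmult_comm]; lra.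
    - intros t Ht; specialize (Hsup t ltac:(lra)); specialize (HG t Ht).
      apply Rmult_le_pos; lra. }
  assert (HG : forall t, a <= t <= b -> 0 < G t).
  { apply positive_continuation; [| exact HGa |].
    - intros t Ht; apply (ex_derive_continuous (V := R_NormedModule) G).
      eexists; apply DG, Ht.
    - intros c Hc Hpos Hzero.
      assert (HG0 : forall t, a <= t <= c -> 0 <= G t).
      { intros t [Ht [Htc | ->]]; [left; apply Hpos; lra | lra]. }
      (* At a first zero c of G, the quotient G / w would still be at least its positive initial
         value, since its derivative is K / w^2 > 0. *)
      assert (Hquot : G a / w a + 0 * (c - a) <= G c / w c).
      { apply (growth_lower_bound (fun t => G t / w t) (fun t => K t / w t ^ 2)); [lra | |].
        - intros t Ht; specialize (Hw t ltac:(lra)).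
          pose proof (is_derive_div G w t _ _ (DG t ltac:(lra)) (Dw t ltac:(lra)) ltac:(lra)) as D.
          exact D.
        - intros t Ht.
          assert (K a <= K t) by (apply (HK t); [lra | intros x Hx; apply HG0; lra]).
          left; apply Rdiv_lt_0_compat; [lra | apply pow_lt, Hw; lra]. }
      assert (0 < G a / w a) by (apply Rdiv_lt_0_compat; [exact HGa | apply Hw; lra]).
      rewrite Hzero in Hquot; unfold Rdiv in Hquot at 2; lra. }
  intros t Ht; split; [apply HG, Ht |].
  apply HK; [exact Ht |]; intros x Hx; left; apply HG; lra.
Qed.

Lemma is_derive_shift (w : R -> R) (c t d : R) :
  is_derive w (t + c) d -> is_derive (fun t => w (t + c)) t d.
Proof.
  intros Hw.
  pose proof (is_derive_comp w (fun t => t + c) t d 1 Hw) as D.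
  replace d with (scal 1 d) by (unfold scal; simpl; unfold mult; simpl; ring).
  apply D; auto_derive; [exact I | ring].
Qed.

Record shifted_solution (Q : R -> R) (t0 : R) (G G1 : R -> R) : Prop := {
  shifted_d1 : forall t, 0 < t -> is_derive G t (G1 t);
  shifted_d2 : forall t, 0 < t ->
    is_derive G1 t ((2 / (t + t0) ^ 2 - 3 * Q (t + t0) ^ 2) * G t);
  shifted_lim0 : filterlim (fun h => (G h - G 0) / h) (at_right 0) (locally 1);
  shifted_0 : G 0 = 0
}.

Definition wronskian (G G1 : R -> R) (t0 : R) (w w1 : R -> R) (t : R) : R :=
  G1 t * w (t + t0) - G t * w1 (t + t0).

(** For w > 0 this says that G is positive and G / w is increasing at t; it is the invariant carried
    from one supersolution to the next. *)
Definition ahead (G G1 : R -> R) (t0 : R) (w w1 : R -> R) (t : R) : Prop :=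
  0 < G t /\ 0 < wronskian G G1 t0 w w1 t.

Lemma wronskian_mono (Q G G1 w w1 w2 : R -> R) (t0 a b : R)
    (hG : shifted_solution Q t0 G G1) :
  0 < a -> (forall s, a + t0 <= s <= b + t0 -> supersolution Q w w1 w2 s) ->
  ahead G G1 t0 w w1 a ->
  forall t, a <= t <= b ->
  0 < G t /\ wronskian G G1 t0 w w1 a <= wronskian G G1 t0 w w1 t.
Proof.
  intros Ha Hsup [HGa HKa].
  apply (sturm_comparison G G1 (fun t => 2 / (t + t0) ^ 2 - 3 * Q (t + t0) ^ 2)
    (fun t => w (t + t0)) (fun t => w1 (t + t0)) (fun t => w2 (t + t0)));
    try assumption; intros t Ht.
  - apply (shifted_d1 _ _ _ _ hG); lra.
  - apply (shifted_d2 _ _ _ _ hG); lra.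
  - apply is_derive_shift, Hsup; lra.
  - apply is_derive_shift, Hsup; lra.
  - apply Hsup; lra.
  - apply Hsup; lra.
Qed.

Lemma ahead_mono (Q G G1 w w1 w2 : R -> R) (t0 a b : R) (hG : shifted_solution Q t0 G G1) :
  0 < a -> (forall s, a + t0 <= s <= b + t0 -> supersolution Q w w1 w2 s) ->
  ahead G G1 t0 w w1 a -> forall t, a <= t <= b -> ahead G G1 t0 w w1 t.
Proof.
  intros Ha Hsup Hahead t Ht.
  destruct (wronskian_mono Q G G1 w w1 w2 t0 a b hG Ha Hsup Hahead t Ht) as [H1 H2].
  split; [exact H1 | destruct Hahead; lra].
Qed.

(** The logarithmic slopes satisfy G'/G > w'/w >= v'/v. *)
Lemma ahead_kink (G G1 w w1 v v1 : R -> R) (t0 t : R) :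
  0 < w (t + t0) -> 0 < v (t + t0) ->
  v1 (t + t0) * w (t + t0) <= w1 (t + t0) * v (t + t0) ->
  ahead G G1 t0 w w1 t -> ahead G G1 t0 v v1 t.
Proof.
  unfold ahead, wronskian; intros Hw Hv Hk [HG HK]; split; [exact HG |].
  apply (Rmult_lt_reg_r (w (t + t0))); [exact Hw |].
  assert (G t * (v1 (t + t0) * w (t + t0)) <= G t * (w1 (t + t0) * v (t + t0)))
    by (apply Rmult_le_compat_l; lra).
  nra.
Qed.

(** Near 0 the function G is close to t, while w is close to w(t0) > 0. The data give a difference
    quotient of G at 0, so a point where G' is bounded below is taken from the mean value
    theorem. *)
Lemma ahead_start (Q G G1 w w1 w2 : R -> R) (t0 e : R) (hG : shifted_solution Q t0 G G1) :
  supersolution Q w w1 w2 t0 -> 0 < e -> exists t, 0 < t < e /\ ahead G G1 t0 w w1 t.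
Proof.
  intros [Dw [Dw1 [Hw _]]] He.
  destruct (lim_right_close _ _ (1 / 2) (shifted_lim0 _ _ _ _ hG) ltac:(lra))
    as [d1 [Hd1 Hlin]].
  assert (HG : forall t, 0 < t < d1 -> t / 2 < G t < 2 * t).
  { intros t Ht; specialize (Hlin t Ht).
    rewrite (shifted_0 _ _ _ _ hG), Rminus_0_r in Hlin; apply Rabs_def2 in Hlin.
    assert (E : G t = G t / t * t) by (field; lra).
    nra. }
  destruct (continuous_pos (fun s => w s - w t0 / 2) t0) as [d2 [Hd2 Hw2]]; [| lra |].
  { apply (continuous_minus w (fun _ => w t0 / 2)); [| apply continuous_const].
    apply (ex_derive_continuous (V := R_NormedModule) w); eexists; exact Dw. }
  destruct (continuous_pos (fun s => (w1 t0 + 1) - w1 s) t0) as [d3 [Hd3 Hw3]]; [| lra |].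
  { apply (continuous_minus (fun _ => w1 t0 + 1) w1); [apply continuous_const |].
    apply (ex_derive_continuous (V := R_NormedModule) w1); eexists; exact Dw1. }
  set (C := Rabs (w1 t0) + 1).
  pose proof (Rabs_pos (w1 t0)) as HC0; pose proof (Rle_abs (w1 t0)) as HC1.
  (* With t/2 < G < 2 t, the mean slope on [r/8, r] exceeds 1/4, so G' w > w(t0)/8, while the last
     bound on r gives G w' <= w(t0)/16. *)
  set (r := Rmin (Rmin (d1 / 2) (e / 2)) (Rmin (Rmin (d2 / 2) (d3 / 2)) (w t0 / (32 * C)))).
  assert (HC : 0 < w t0 / (32 * C)) by (apply Rdiv_lt_0_compat; unfold C; lra).
  assert (Hr : 0 < r /\ r <= d1 / 2 /\ r <= e / 2 /\ r <= d2 / 2 /\ r <= d3 / 2 /\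
               r <= w t0 / (32 * C)).
  { unfold r; repeat apply Rmin_case_strong; intros; repeat split; lra. }
  destruct Hr as [Hr0 [Hr1 [Hr2 [Hr3 [Hr4 Hr5]]]]].
  destruct (mean_value G G1 (r / 8) r) as [x [Hx Ex]]; [lra | |].
  { intros t Ht; apply (shifted_d1 _ _ _ _ hG); lra. }
  exists x; split; [lra |].
  pose proof (HG x ltac:(lra)) as Gx; pose proof (HG r ltac:(lra)) as Gr;
    pose proof (HG (r / 8) ltac:(lra)) as Gr8.
  specialize (Hw2 (x + t0) ltac:(apply Rabs_def1; lra)).
  specialize (Hw3 (x + t0) ltac:(apply Rabs_def1; lra)).
  split; [lra |]; unfold wronskian.
  assert (Hslope : 1 / 4 < G1 x) by nra.
  assert (HGw : G x * w1 (x + t0) <= w t0 / 16).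
  { assert (Hrc : r * (32 * C) <= w t0).
    { replace (w t0) with (w t0 / (32 * C) * (32 * C)) by (field; unfold C; lra).
      apply Rmult_le_compat_r; [unfold C; lra | exact Hr5]. }
    assert (G x * w1 (x + t0) <= G x * C) by (apply Rmult_le_compat_l; unfold C; lra).
    assert (G x * C <= 2 * r * C) by (apply Rmult_le_compat_r; unfold C; lra).
    lra. }
  nra.
Qed.

Lemma ahead_out (Q Q1 G G1 : R -> R) (t0 a : R) (h : profile Q Q1)
    (hG : shifted_solution Q t0 G G1) :
  0 < a -> 5 / 2 <= a + t0 -> ahead G G1 t0 w_out w_out1 a ->
  forall t, a <= t -> ahead G G1 t0 w_out w_out1 t.
Proof.
  intros Ha Hs Hahead t Ht.
  apply (ahead_mono Q G G1 w_out w_out1 w_out2 t0 a t hG Ha); [| exact Hahead | lra].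
  intros s Hs'; apply (supersolution_out Q Q1 h); lra.
Qed.

(** Follows the invariant through the middle zone and exchanges the supersolution at 5/2. Only
    positivity and the final invariant are kept, so that zones can be chained. *)
Lemma ahead_mid (Q Q1 G G1 : R -> R) (t0 a : R) (h : profile Q Q1)
    (hG : shifted_solution Q t0 G G1) :
  0 < a -> 11 / 8 <= a + t0 <= 5 / 2 -> ahead G G1 t0 w_mid0 w_mid1 a ->
  forall t, a <= t -> 0 < G t /\ (5 / 2 <= t + t0 -> ahead G G1 t0 w_out w_out1 t).
Proof.
  intros Ha Hs Hahead.
  assert (Hmid : forall t, a <= t <= 5 / 2 - t0 -> ahead G G1 t0 w_mid0 w_mid1 t).
  { apply (ahead_mono Q G G1 w_mid0 w_mid1 w_mid2 t0 a _ hG Ha); [| exact Hahead].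
    intros s Hs'; apply (supersolution_mid Q Q1 h); lra. }
  assert (Hout : forall t, 5 / 2 - t0 <= t -> ahead G G1 t0 w_out w_out1 t).
  { apply (ahead_out Q Q1 G G1 t0 _ h hG); [lra | lra |].
    apply (ahead_kink G G1 w_mid0 w_mid1).
    1-3: replace (5 / 2 - t0 + t0) with (5 / 2) by ring.
    - apply (supersolution_mid Q Q1 h); lra.
    - apply (supersolution_out Q Q1 h); lra.
    - apply kink_mid_out.
    - apply Hmid; lra. }
  intros t Ht; split.
  - destruct (Rle_or_lt t (5 / 2 - t0)); [apply Hmid | apply Hout]; lra.
  - intros Ht'; apply Hout; lra.
Qed.

Lemma ahead_in (Q Q1 G G1 : R -> R) (t0 a : R) (h : profile Q Q1)
    (hG : shifted_solution Q t0 G G1) :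
  0 < a -> 51 / 256 < a + t0 <= 11 / 8 -> ahead G G1 t0 (ev1 w_in) w_in1 a ->
  forall t, a <= t -> 0 < G t /\ (5 / 2 <= t + t0 -> ahead G G1 t0 w_out w_out1 t).
Proof.
  intros Ha Hs Hahead.
  assert (Hin : forall t, a <= t <= 11 / 8 - t0 -> ahead G G1 t0 (ev1 w_in) w_in1 t).
  { apply (ahead_mono Q G G1 (ev1 w_in) w_in1 w_in2 t0 a _ hG Ha); [| exact Hahead].
    intros s Hs'; apply (supersolution_in Q Q1 h); lra. }
  assert (Hmid : forall t, 11 / 8 - t0 <= t ->
            0 < G t /\ (5 / 2 <= t + t0 -> ahead G G1 t0 w_out w_out1 t)).
  { apply (ahead_mid Q Q1 G G1 t0 _ h hG); [lra | lra |].
    apply (ahead_kink G G1 (ev1 w_in) w_in1).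
    1-3: replace (11 / 8 - t0 + t0) with (11 / 8) by ring.
    - apply (supersolution_in Q Q1 h); lra.
    - apply (supersolution_mid Q Q1 h); lra.
    - apply kink_in_mid.
    - apply Hin; lra. }
  intros t Ht; destruct (Rle_or_lt t (11 / 8 - t0)); [| apply Hmid; lra].
  split; [apply Hin; lra | lra].
Qed.

Lemma solution_ahead (Q Q1 G G1 : R -> R) (t0 : R) (h : profile Q Q1)
    (hG : shifted_solution Q t0 G G1) :
  1 / 5 <= t0 ->
  forall t, 0 < t -> 0 < G t /\ (5 / 2 <= t + t0 -> ahead G G1 t0 w_out w_out1 t).
Proof.
  intros Ht0 t Ht.
  destruct (Rlt_or_le t0 (11 / 8)) as [H1 | H1].
  (* The starting time is taken before [t] and before the next junction. *)
  - destruct (ahead_start Q G G1 (ev1 w_in) w_in1 w_in2 t0 (Rmin t (11 / 8 - t0)) hG)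
      as [a [Ha Hahead]];
      [apply (supersolution_in Q Q1 h); lra | apply Rmin_pos; lra |].
    pose proof (Rmin_l t (11 / 8 - t0)); pose proof (Rmin_r t (11 / 8 - t0)).
    apply (ahead_in Q Q1 G G1 t0 a h hG); try assumption; lra.
  - destruct (Rlt_or_le t0 (5 / 2)) as [H2 | H2].
    + destruct (ahead_start Q G G1 w_mid0 w_mid1 w_mid2 t0 (Rmin t (5 / 2 - t0)) hG)
        as [a [Ha Hahead]];
        [apply (supersolution_mid Q Q1 h); lra | apply Rmin_pos; lra |].
      pose proof (Rmin_l t (5 / 2 - t0)); pose proof (Rmin_r t (5 / 2 - t0)).
      apply (ahead_mid Q Q1 G G1 t0 a h hG); try assumption; lra.
    + destruct (ahead_start Q G G1 w_out w_out1 w_out2 t0 t hG) as [a [Ha Hahead]];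
        [apply (supersolution_out Q Q1 h); lra | lra |].
      assert (Hout : ahead G G1 t0 w_out w_out1 t)
        by (apply (ahead_out Q Q1 G G1 t0 a h hG); try assumption; lra).
      split; [apply Hout | intros _; exact Hout].
Qed.

(* [G / w_out] has slope bounded below, and [w_out] is bounded below. *)
Lemma linear_growth (Q Q1 G G1 : R -> R) (t0 : R) (h : profile Q Q1)
    (hG : shifted_solution Q t0 G G1) :
  1 / 5 <= t0 -> exists c, 0 < c /\ forall t, 5 / 2 <= t -> c * t < G t.
Proof.
  intros Ht0.
  destruct (solution_ahead Q Q1 G G1 t0 h hG Ht0 (5 / 2) ltac:(lra)) as [HG0 Hahead].
  specialize (Hahead ltac:(lra)).
  set (K := wronskian G G1 t0 w_out w_out1 (5 / 2)).
  assert (HK : 0 < K) by apply Hahead.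
  assert (Hw : forall t, 5 / 2 <= t -> 1 / 4 < w_out (t + t0) <= 1).
  { intros t Ht; unfold w_out.
    assert (0 < / (t + t0)) by (apply Rinv_0_lt_compat; lra).
    assert (/ (t + t0) <= / (5 / 2)) by (apply Rinv_le_contravar; lra).
    lra. }
  (* Since w <= 1, G / w starts above m * 5/2 and has slope at least m, so it dominates m t; the
     factor w > 1/4 then gives the constant m/4. *)
  set (m := Rmin K (G (5 / 2) / (5 / 2))).
  assert (Hm : 0 < m /\ m <= K /\ m * (5 / 2) <= G (5 / 2)).
  { assert (0 < G (5 / 2) / (5 / 2)) by lra.
    unfold m; apply Rmin_case_strong; intros; repeat split; lra. }
  exists (m / 4); split; [lra |]; intros t Ht.
  assert (Hquot : G (5 / 2) / w_out (5 / 2 + t0) + K * (t - 5 / 2) <= G t / w_out (t + t0)).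
  { apply (growth_lower_bound (fun t => G t / w_out (t + t0))
      (fun t => wronskian G G1 t0 w_out w_out1 t / w_out (t + t0) ^ 2)); [lra | |].
    - intros x Hx; pose proof (Hw x ltac:(lra)).
      assert (Dw : is_derive (fun t => w_out (t + t0)) x (w_out1 (x + t0)))
        by (apply is_derive_shift, (supersolution_out Q Q1 h); lra).
      pose proof (is_derive_div G (fun t => w_out (t + t0)) x _ _
        (shifted_d1 _ _ _ _ hG x ltac:(lra)) Dw ltac:(lra)) as D.
      exact D.
    - intros x Hx; pose proof (Hw x ltac:(lra)) as Hwx.
      destruct (wronskian_mono Q G G1 w_out w_out1 w_out2 t0 (5 / 2) x hG ltac:(lra))
        with (t := x) as [_ HKx];
        [intros s Hs; apply (supersolution_out Q Q1 h); lra | exact Hahead | lra |].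
      fold K in HKx.
      apply (Rmult_le_reg_r (w_out (x + t0) ^ 2)); [apply pow_lt; lra |].
      field_simplify; [| lra].
      assert (w_out (x + t0) ^ 2 <= 1) by nra.
      nra. }
  assert (Hq0 : G (5 / 2) <= G (5 / 2) / w_out (5 / 2 + t0)).
  { pose proof (Hw (5 / 2) ltac:(lra)).
    apply (Rmult_le_reg_r (w_out (5 / 2 + t0))); [lra |]; field_simplify; [nra | lra]. }
  pose proof (Hw t Ht) as Hwt.
  assert (Hmt : m * t <= G t / w_out (t + t0)) by nra.
  assert (E : G t = G t / w_out (t + t0) * w_out (t + t0)) by (field; lra).
  assert (0 < m * t) by nra.
  nra.
Qed.

Theorem proposition4p1 (Q : R -> R) (hQ : is_ground_state_profile Q)
    (t0 : R) (ht0 : 1/5 <= t0) (G G1 : R -> R)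
    (hG : forall t, 0 < t -> is_derive G t (G1 t))
    (hG1 : forall t, 0 < t ->
        is_derive G1 t ((2 / (t + t0) ^ 2 - 3 * Q (t + t0) ^ 2) * G t))
    (hG0 : G 0 = 0)
    (hGd0 : filterlim (fun h => (G h - G 0) / h) (at_right 0) (locally 1)) :
  (forall t, 0 < t -> 0 < G t) /\
  exists c c2 : R, 0 < c /\ 0 < c2 /\
    forall t, 5/2 <= t -> c * Rpower t c2 < G t.
Proof.
  destruct hQ as [Hpos [Q1 [D1 [D2 [L0 [L1 Linf]]]]]].
  assert (h : profile Q Q1) by (constructor; assumption).
  assert (hS : shifted_solution Q t0 G G1) by (constructor; assumption).
  split.
  - intros t Ht; apply (proj1 (solution_ahead Q Q1 G G1 t0 h hS ht0 t Ht)).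
  - destruct (linear_growth Q Q1 G G1 t0 h hS ht0) as [c [Hc Hgrow]].
    exists c, 1; split; [exact Hc | split; [lra |]].
    intros t Ht; rewrite Rpower_1 by lra; apply Hgrow, Ht.
Qed.
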